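(* Let $W_n(r)$ be the number of isolated nodes (vertices of degree zero) in $G_n(r)$, and define the random variables $d_n = \inf\{r>0 : W_n(r) = 0\}$, $n \ge 1$. (i) Suppose that $g(r) = o(r^{-c})$ as $r\to\infty$ for some $c>d$. Then almost surely $$\limsup_{n\to\infty} \frac{\alpha n d_n^d}{\log n} \le 1.$$ (ii) If $g(r) = o(e^{-cr})$ as $r\to\infty$ for some $c>0$, then almost surely $$\lim_{n\to\infty} \frac{\alpha n d_n^d}{\log n} = 1.$$ (iii) If $g(r) = o(r^{-c})$ as $r\to\infty$ for some $c>3d$, then almost surely $$\liminf_{n\to\infty} \frac{\alpha n d_n^d}{\log n} \ge \frac{c-3d}{c-d}.$$
   Context: Let $d \ge 2$ and $S = \left(-\frac12,\frac12\right]^d$, equipped with the toroidal metric $d(x,y) = \inf\{|x-y-z| : z \in \mathbb{Z}^d\}$, where $|\cdot|$ is the Euclidean norm. (The letter $d$ denotes the dimension; $d(\cdot,\cdot)$ denotes the metric; $d_n^d$ is the $d$-th power of $d_n$.) The connection function $g:[0,\infty)\to[0,1]$ is non-increasing with $0 < \alpha := \int_{\mathbb{R}^d} g(|x|)\,dx < \infty$. On one probability space $(\Omega,\mathcal{F},P)$ let $X_1,X_2,\ldots$ be independent and uniformly distributed on $S$; let $\{N_n\}_{n\ge1}$ be a non-decreasing sequence of random variables with $N_n$ Poisson of mean $n$; and let $\{U_{ij}\}$ be independent uniform random variables on $[0,1]$; these three families are independent of each other. Set $\mathcal{P}_n = \{X_1,\ldots,X_{N_n}\}$, a Poisson point process of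 intensity $n$ on $S$. For $r>0$, $G_n(r)$ is the (undirected) graph with vertex set $\mathcal{P}_n$ in which $X_i,X_j\in\mathcal{P}_n$, $i<j$, are joined by an edge iff $U_{ij} \le g\left(\frac{d(X_i,X_j)}{r}\right)$. The almost sure statements refer to this coupled family of graphs. *)

(* Defs.v *)
From HB Require Import structures.
From mathcomp Require Import all_boot all_order all_algebra.
From mathcomp Require Import all_classical all_reals all_analysis.

Set Implicit Arguments.
Unset Strict Implicit.
Unset Printing Implicit Defensive.

Import Order.TTheory GRing.Theory Num.Theory.
Import numFieldNormedType.Exports.

Local Open Scope classical_set_scope.
Local Open Scope ring_scope.

(* Makes [+oo] usable as the filter of the library's [f =o_F h]. *)
Canonical pinfty_filter_on (R : numFieldType) :=
  FilterType (pinfty_nbhs R) (@filter_filter _ _ (@proper_pinfty_nbhs R)).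

(* Points of R^n are n-tuples, with the library's product sigma-algebra; the
   factor is [measurableTypeR R], the Borel structure that carries
   [lebesgue_measure]. *)
Notation Rn R n := (n.-tuple (measurableTypeR R)).

(* The library has no n-dimensional Lebesgue measure: it is built here as the
   iterated product of the one-dimensional one, transported along
   (x, (x_1, ..., x_n)) |-> (x, x_1, ..., x_n). *)
Section cons_measure.
Context (R : realType) (n : nat).
Variable m : {sigma_finite_measure set (Rn R n) -> \bar R}.

Definition tcons (p : measurableTypeR R * Rn R n) : Rn R n.+1 :=
  [tuple of p.1 :: p.2].

Lemma measurable_tcons : measurable_fun setT tcons.
Proof. exact: measurable_cons. Qed.

HB.instance Definition _ :=
  isMeasurableFun.Build _ _ _ _ tcons measurable_tcons.

Definition cons_measure : set (Rn R n.+1) -> \bar R :=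
  pushforward (@lebesgue_measure R \x m)%E tcons.

Let cons_measure0 : cons_measure set0 = 0%E.
Proof. exact: measure0. Qed.

Let cons_measure_ge0 A : (0 <= cons_measure A)%E.
Proof. exact: measure_ge0. Qed.

Let cons_measure_sigma_additive : semi_sigma_additive cons_measure.
Proof. exact: measure_semi_sigma_additive. Qed.

HB.instance Definition _ := isMeasure.Build _ _ _ cons_measure
  cons_measure0 cons_measure_ge0 cons_measure_sigma_additive.

Lemma sigma_finite_cons_measure : sigma_finite setT cons_measure.
Proof.
have /sigma_finiteP[F [FT ndF Foo]] := sigma_finiteT (@lebesgue_measure R).
have /sigma_finiteP[G [GT ndG Goo]] := sigma_finiteT m.
pose H k : set (Rn R n.+1) :=
  [set t | F k (thead t) /\ G k [tuple of behead t]].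
exists H.
  rewrite predeqE => t; split=> // _.
  have : [set: R] (thead t) by []. rewrite FT => -[i _ Fi].
  have : [set: Rn R n] [tuple of behead t] by []. rewrite GT => -[j _ Gj].
  exists (maxn i j) => //; split.
    by move: (thead t) Fi; exact/subsetPset/ndF/leq_maxl.
  by move: Gj; apply/subsetPset/ndG/leq_maxr.
move=> k; have [mF Fk] := Foo k; have [mG Gk] := Goo k.
have beheadK (x : R) (t : Rn R n) :
    [tuple of behead (tcons (x, t))] = t :> Rn R n by exact: val_inj.
have HE : tcons @^-1` H k = F k `*` G k.
  by apply/seteqP; split=> -[x t]; rewrite /H/= beheadK.
split; last first.
  rewrite /cons_measure /pushforward HE product_measure1E//.
  by rewrite lte_mul_pinfty// ge0_fin_numE.
rewrite (_ : H k = (@tnth n.+1 R ^~ ord0) @^-1` (F k) `&`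
   (fun t : Rn R n.+1 => [tuple of behead t]) @^-1` (G k)) //.
apply: measurableI.
  by rewrite -[X in measurable X]setTI; exact: measurable_tnth.
by rewrite -[X in measurable X]setTI; exact: measurable_behead.
Qed.

HB.instance Definition _ :=
  Measure_isSigmaFinite.Build _ _ _ cons_measure sigma_finite_cons_measure.

End cons_measure.

Fixpoint leb (R : realType) (n : nat) :
    {sigma_finite_measure set (Rn R n) -> \bar R} :=
  match n with
  | 0 => \d_([tuple] : Rn R 0)
  | n'.+1 => cons_measure (leb R n')
  end.

Lemma leb_box (R : realType) (n : nat) (A : 'I_n -> set (measurableTypeR R)) :
  (forall i, measurable (A i)) ->
  (leb R n [set t | forall i, A i (tnth t i)] =
   \prod_(i < n) lebesgue_measure (A i))%E.
Proof.
elim: n A => [|n IHn] A mA.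
  by rewrite big_ord0 /= diracE mem_set// => -[].
rewrite big_ord_recl -IHn => [|i]; last exact: mA.
rewrite [LHS]/= /cons_measure /pushforward.
rewrite (_ : _ @^-1` _ =
  A ord0 `*` [set t : Rn R n | forall i, A (lift ord0 i) (tnth t i)]).
  rewrite product_measure1E//.
  rewrite (_ : [set _ | _] = \bigcap_(i in [set: 'I_n])
    (@tnth n (measurableTypeR R) ^~ i) @^-1` A (lift ord0 i)); last first.
    by apply/seteqP; split=> t /= tA i; [move=> _|]; exact: tA.
  apply: fin_bigcap_measurable => // i _.
  by rewrite -[X in measurable X]setTI; exact: measurable_tnth.
apply/seteqP; split=> -[x t] /=.
  move=> tA; split; first exact: (tA ord0).
  by move=> i; have := tA (lift ord0 i); rewrite tnthS.
case=> xA tA i; case: (unliftP ord0 i) => [j|] -> //.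
by rewrite tnthS.
Qed.

Section torus.
Context (R : realType) (d : nat).

Definition enorm (x : Rn R d) : R := Num.sqrt (\sum_(k < d) tnth x k ^+ 2).

Definition torus : set (Rn R d) :=
  [set x | forall k : 'I_d, - (1 / 2) < tnth x k <= 1 / 2].

Definition torus_dist (x y : Rn R d) : R :=
  inf (range (fun z : d.-tuple int =>
    enorm [tuple tnth x k - tnth y k - (tnth z k)%:~R | k < d])).

End torus.

Arguments torus : clear implicits.

Section independence.
Context (disp : measure_display) (Omega : measurableType disp) (R : realType).
Variable P : probability Omega R.
Context (disp' : measure_display) (T : measurableType disp') (I : choiceType).

(* Mutual independence of the random elements (X i)_{i in D}. *)
Definition independent_family (D : set I) (X : I -> Omega -> T) : Prop :=
  forall (s : seq I) (A : I -> set T),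
    uniq s -> [set` s] `<=` D -> (forall i, measurable (A i)) ->
    P (\bigcap_(i in [set` s]) X i @^-1` A i) =
    (\prod_(i <- s) P (X i @^-1` A i))%E.

(* The sigma-algebra on Omega generated by (X i)_{i in D}. *)
Definition sigma_family (D : set I) (X : I -> Omega -> T) : set (set Omega) :=
  <<s \bigcup_(i in D) preimage_set_system setT (X i) measurable >>.

End independence.

(* As each sigma-algebra contains the whole space, the product rule for triples
   contains the one for pairs. *)
Definition independent_sigma3 (disp : measure_display)
    (Omega : measurableType disp) (R : realType) (P : probability Omega R)
    (F1 F2 F3 : set (set Omega)) : Prop :=
  forall A B C, F1 A -> F2 B -> F3 C ->
    P (A `&` B `&` C) = (P A * P B * P C)%E.

(* One realisation of the graph G(r): [N] points x_0, ..., x_(N-1) (indices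
   shifted by one from X_1, ..., X_N), marks u_ij read only for i < j.  A
   vertex is represented by its index. *)
Section graph.
Context (R : realType) (d : nat).
Variables (g : R -> R) (N : nat) (x : nat -> Rn R d) (u : nat -> nat -> R).

Definition adj (r : R) : rel 'I_N := fun i j =>
  (i != j) && (u (minn i j) (maxn i j) <= g (torus_dist (x i) (x j) / r)).

Definition isolated_count (r : R) : nat :=
  #|[set i : 'I_N | [forall j : 'I_N, ~~ adj r i j]]|.

(* In the extended reals: the set of radii may be empty (for instance when
   N = 1), and its infimum is then +oo. *)
Definition no_isolated_radius : \bar R :=
  ereal_inf [set r%:E | r in [set r : R | 0 < r /\ isolated_count r = 0%N]].

End graph.

(* Main.v *)
Require Import Defs.
From HB Require Import structures.
From mathcomp Require Import all_boot all_order all_algebra.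
From mathcomp Require Import all_classical all_reals all_analysis.
From mathcomp Require Import measurable_realfun.
From mathcomp Require Import ring lra zify.

(** The ratio [alpha * n * d_n ^ d / ln n] converges to 1 almost surely; the
    three claims follow because [(c - 3 d) / (c - d) <= 1].

    Reduction to independent points. Adjacency is monotone in the radius, so
    [d_n <= r] when no vertex is isolated at radius [r], and [r <= d_n] when some
    vertex is. A Chernoff bound for the Poisson law gives, for each [lam > 1],
    [n / lam < N_n < lam * n] for all large [n] ([poisson_concentration]). Thus,
    for every [n] between [lam ^ k] and [lam ^ (k + 1)], the number of vertices
    lies between two deterministic numbers [few k] and [many k], which are about
    [lam ^ (k - 1)] and [lam ^ (k + 2)]. A vertex isolated in such a graph is one
    of the first [many k] points and has no neighbour among the first [few k];
    conversely, one of the first [few k] points without neighbour among the first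
    [many k] is an isolated vertex of all these graphs. So each [k] requires one
    event for the upper bound and one for the lower bound, about independent
    uniform points and marks only. Both have probabilities that decay
    geometrically in [k], and the Borel-Cantelli lemma concludes
    ([ae_none_isolated_above], [ae_some_isolated_below]).

    One point. As the torus is homogeneous ([leb_torus_sub]), a point is joined to
    a fresh uniform point with a probability [p] that does not depend on its
    position, and rescaling shows that [p] is at most [alpha * r ^ d], and at
    least [beta * r ^ d] for each [beta < alpha] and small [r]. Integrating marks
    and positions out one at a time gives exactly [(1 - p) ^ m] for the
    probability of having no neighbour among [m] other points
    ([mean_unjoined_all]). With [alpha * n * r ^ d] about [(1 + eps) * ln n], a
    union bound leaves a negative power of [n].

    Two points. Given the positions [x] and [y], a fresh point is joined to
    neither with probability [1 - 2 * p + q x y], where the overlap [q] takes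
    values in [[0, p]] and has mean [p ^ 2] ([mean_overlap]). By convexity of the
    power function, [(1 - 2 * p + q) ^ m <= (1 - p) ^ (2 * m) + q / p * (1 - p) ^ m],
    so the probability that neither of two points has a neighbour among [m] others
    is at most [(1 - p) ^ (2 * m) + p * (1 - p) ^ m] ([mean_unjoined_pair_le]).
    The last term is negligible with respect to the first one when [m * p] is
    about [(1 - eps) * ln m]: isolation of two points is nearly uncorrelated, and
    the second-moment method bounds the probability that there is no isolated
    point by a negative power of [m] ([prob_none_isolated_le]). *)

Set Implicit Arguments.
Unset Strict Implicit.
Unset Printing Implicit Defensive.

Import Order.TTheory GRing.Theory Num.Theory.
Import numFieldNormedType.Exports.

Local Open Scope classical_set_scope.
Local Open Scope ring_scope.

(** * Lebesgue measure on the line and reduction modulo 1 *)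

Section one_dimensional_lebesgue.
Context {R : realType}.
Notation leb1 := (@lebesgue_measure R).

Lemma lebesgue_measure_reflect (a : R) (A : set (measurableTypeR R)) :
  measurable A -> leb1 ((fun y => a - y) @^-1` A) = leb1 A.
Proof.
have mf : measurable_fun [set: measurableTypeR R]
    (fun y : measurableTypeR R => a - y : measurableTypeR R).
  exact: measurable_funB.
pose f : {mfun measurableTypeR R >-> measurableTypeR R} := HB.pack
  (fun y : measurableTypeR R => a - y : measurableTypeR R)
  (isMeasurableFun.Build _ _ _ _ _ mf).
move=> mA; apply/esym.
apply: (@lebesgue_measure_unique R (pushforward leb1 f)) => // X [[u v] /= _ <-].
rewrite /pushforward (_ : _ @^-1` _ = `[a - v, a - u[%classic); last first.
  by apply/seteqP; split => y /=; rewrite !in_itv/=; lra.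
by rewrite !lebesgue_measure_itv/= !lte_fin; case: ifP; case: ifP => ? ?;
   rewrite -?EFinB; try (congr EFin); lra.
Qed.

Lemma lebesgue_measure_dilate (r : R) (A : set (measurableTypeR R)) : 0 < r ->
  measurable A -> leb1 ((fun y => r * y) @^-1` A) = (r^-1%:E * leb1 A)%E.
Proof.
move=> r0.
have mf : measurable_fun [set: measurableTypeR R]
    (fun y : measurableTypeR R => r * y : measurableTypeR R).
  exact: measurable_funM.
pose f : {mfun measurableTypeR R >-> measurableTypeR R} := HB.pack
  (fun y : measurableTypeR R => r * y : measurableTypeR R)
  (isMeasurableFun.Build _ _ _ _ _ mf).
have r0' : 0 <= r by exact: ltW.
pose s : {nonneg R} := NngNum r0'.
move=> mA.
pose mu : {measure set (measurableTypeR R) -> \bar R} :=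
  mscale s (measure_function_pushforward__canonical__measure_function_Measure leb1 mf).
have -> : leb1 A = mu A.
  apply: (@lebesgue_measure_unique R mu) => // X [[u v] /= _ <-].
  rewrite /mu.
  rewrite /mscale/= /pushforward (_ : _ @^-1` _ = `]u / r, v / r]%classic); last first.
    by apply/seteqP; split => y /=; rewrite !in_itv/= ltr_pdivrMr// ler_pdivlMr// ![y * _]mulrC.
  rewrite !lebesgue_measure_itv/= !lte_fin ltr_pM2r ?invr_gt0//.
  case: ifP => _; rewrite ?mule0// -!EFinB -EFinM; congr EFin.
  by rewrite -mulrBl mulrC divfK ?gt_eqF.
rewrite /mscale/= /pushforward muleA -EFinM mulVf ?mul1e ?gt_eqF//.
Qed.

(** The representative of [v] modulo 1 that is closest to 0. *)
Definition recenter (v : R) : R := v - (Num.ceil (v - 1 / 2))%:~R.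

Lemma recenter_itv v : - (1 / 2) < recenter v <= 1 / 2.
Proof. by rewrite /recenter; have := ceil_itv (v - 1 / 2); rewrite intrB; lra. Qed.

Lemma recenter_addz v (z : int) : recenter (v + z%:~R) = recenter v.
Proof.
have e : v + z%:~R - 1 / 2 = (v - 1 / 2) + z%:~R by ring.
rewrite /recenter e ceilDrz ?intr_int//.
have -> : Num.ceil (z%:~R : R) = z by exact: intrKceil.
by rewrite intrD; ring.
Qed.

Lemma recenter_id v : - (1 / 2) < v <= 1 / 2 -> recenter v = v.
Proof.
move=> /andP[v1 v2]; rewrite /recenter (_ : Num.ceil _ = 0) ?subr0//.
by apply/eqP; rewrite ceil_eq; lra.
Qed.

Lemma recenter_shift v : exists z : int, recenter v = v + z%:~R.
Proof. by exists (- Num.ceil (v - 1 / 2)); rewrite /recenter intrN. Qed.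

Lemma recenter_sqr_min v (z : int) : recenter v ^+ 2 <= (v - z%:~R) ^+ 2.
Proof.
have [w1 w2] := andP (recenter_itv v).
have -> : v - z%:~R = recenter v + (Num.ceil (v - 1 / 2) - z)%:~R.
  by rewrite /recenter intrB; ring.
set t := (_ - z)%R; have [->|t0] := eqVneq t 0; first by rewrite addr0.
suff : (1 : R) <= t%:~R \/ (t%:~R : R) <= - 1.
  by move: (recenter v) (t%:~R : R) w1 w2 => w s w1 w2 [s1|s1]; nra.
have [tp|tn] := ltP 0 t; first by left; rewrite -[1]/(1%:~R) ler_int.
right; rewrite -[- 1]/((- 1)%:~R) ler_int; lia.
Qed.

Lemma measurable_recenter : measurable_fun [set: R] recenter.
Proof.
apply: measurable_funB => //; apply: nondecreasing_measurable => // x y xy.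
by rewrite ler_int le_ceil// lerB.
Qed.

(** Reflection of the unit circle preserves length: the reflected set meets the
    fundamental interval in at most three integer translates, each of which
    Lebesgue measure puts back in place. *)
Lemma lebesgue_measure_recenter (a : R) (A : set (measurableTypeR R)) :
  measurable A ->
  leb1 ([set y | A (recenter (a - y))] `&` [set y | - (1 / 2) < y <= 1 / 2]) =
  leb1 (A `&` [set y | - (1 / 2) < y <= 1 / 2]).
Proof.
move=> mA; set I := [set y : R | - (1 / 2) < y <= 1 / 2].
have mI : measurable (I : set (measurableTypeR R)).
  by rewrite (_ : I = `]- (1 / 2), 1 / 2]%classic).
wlog aI : a / I a.
  move=> /(_ (recenter a) (recenter_itv a)) <-; congr (leb1 (_ `&` _)).
  apply/seteqP; split => y /=; have [z ->] := recenter_shift a;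
    by rewrite addrAC recenter_addz.
have mpre z (C : set (measurableTypeR R)) : measurable C ->
    measurable ((fun y => a - z - y) @^-1` C : set (measurableTypeR R)).
  move=> mC; rewrite -[X in measurable X]setTI.
  have mf : measurable_fun [set: measurableTypeR R]
    (fun y : measurableTypeR R => a - z - y : measurableTypeR R).
    exact: measurable_funB.
  exact: mf.
(* [y |-> a - z - y] is an involution that exchanges [B z] and [B' z]; the
   [B z] cut [A `&` I] according to the integer [z] that brings [a - y] into [I]. *)
pose B (z : R) := [set y | (A y /\ I y) /\ I (a - z - y)].
have mB z : measurable (B z : set (measurableTypeR R)).
  rewrite (_ : B z = (A `&` I) `&` ((fun y => a - z - y) @^-1` I)).
    by apply: measurableI; [exact: measurableI|exact: mpre].
  by [].
pose B' (z : R) := (fun y => a - z - y) @^-1` (B z).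
have mB' z : measurable (B' z : set (measurableTypeR R)).
  exact: mpre.
have BB' z : leb1 (B' z) = leb1 (B z) by exact: lebesgue_measure_reflect.
have -> : [set y | A (recenter (a - y))] `&` I = B' 0 `|` (B' 1 `|` B' (-1)).
  apply/seteqP; split => y; rewrite /B' /B /I/=.
    move=> [yA yI]; move: aI; rewrite /I/= => aI.
    have fin z : recenter (a - y) = a - z - y ->
        (A (a - z - y) /\ - (1 / 2) < a - z - y <= 1 / 2) /\
        - (1 / 2) < a - z - (a - z - y) <= 1 / 2.
      move=> e; split; last by move: yI; lra.
      by rewrite -e; split => //; exact: recenter_itv.
    have [y1|y1] := leP (a - y) (- (1 / 2)).
      by right; right; apply: fin; rewrite -(recenter_addz _ 1) recenter_id /=; lra.
    have [y2|y2] := ltP (1 / 2) (a - y).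
      by right; left; apply: fin; rewrite -(recenter_addz _ (-1)) recenter_id /=; lra.
    by left; apply: fin; rewrite recenter_id /=; lra.
  have fin (z : int) (w : R) : w = z%:~R ->
      (A (a - w - y) /\ - (1 / 2) < a - w - y <= 1 / 2) /\
      - (1 / 2) < a - w - (a - w - y) <= 1 / 2 ->
      A (recenter (a - y)) /\ - (1 / 2) < y <= 1 / 2.
    move=> wz [[yA yI] yI']; split; last lra.
    suff -> : recenter (a - y) = a - w - y by [].
    rewrite -(recenter_addz _ (- z)) intrN -wz -[RHS]recenter_id; last exact: yI.
    by congr recenter; ring.
  by case=> [|[|]]; [apply: (fin 0)|apply: (fin 1)|apply: (fin (-1))].
have -> : A `&` I = B 0 `|` (B 1 `|` B (-1)).
  apply/seteqP; split => y; rewrite /B /I/=.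
    move=> [yA yI]; move: aI; rewrite /I/= => aI.
    have [y1|y1] := leP (a - y) (- (1 / 2)); first by right; right; split => //; lra.
    have [y2|y2] := ltP (1 / 2) (a - y); first by right; left; split => //; lra.
    by left; split => //; lra.
  by move=> [|[|]] [[yA yI] _].
have dis (C : R -> set (measurableTypeR R)) : (forall z, measurable (C z)) ->
    (forall z z' y, z - z' >= 1 -> C z y -> C z' y -> False) ->
    leb1 (C 0 `|` (C 1 `|` C (-1))) =
      adde (leb1 (C 0)) (adde (leb1 (C 1)) (leb1 (C (-1)))).
  move=> mC dC.
  have d1 : C 1 `&` C (-1) = set0.
    by apply/seteqP; split => // y [] /dC H /H; apply; lra.
  have d0 : C 0 `&` (C 1 `|` C (-1)) = set0.
    by apply/seteqP; split => // y [] C0 [C1|C1];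
      [apply: (dC 1 0 y) => //|apply: (dC 0 (-1) y) => //]; lra.
  have mU : measurable (C 1 `|` C (-1)) by exact: measurableU.
  by rewrite measureU// measureU.
by rewrite !dis ?BB' // => z z' y zz; rewrite /B' /B /I/=; lra.
Qed.

End one_dimensional_lebesgue.

(** * Lebesgue measure on boxes, the torus and dilations *)

Section boxes.
Context {R : realType} (d : nat).
Notation Rd := (Rn R d).
Implicit Types (A : 'I_d -> set (measurableTypeR R)).

Definition box A : set Rd := [set t | forall i, A i (tnth t i)].

Lemma measurable_box A : (forall i, measurable (A i)) -> measurable (box A).
Proof.
move=> mA; rewrite (_ : box A = \bigcap_(i in [set: 'I_d])
    (@tnth d (measurableTypeR R) ^~ i) @^-1` A i); last first.
  by apply/seteqP; split=> t /= tA i; [move=> _|]; exact: tA.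
apply: fin_bigcap_measurable => // i _.
by rewrite -[X in measurable X]setTI; exact: measurable_tnth.
Qed.

(** Boxes are stable under intersection and contain the cylinders that generate
    the product sigma-algebra. *)
Lemma box_measure_unique (g : nat -> set (measurableTypeR R))
    (m1 m2 : {measure set Rd -> \bar R}) :
  (forall k, measurable (g k)) ->
  \bigcup_k box (fun=> g k) = setT ->
  (forall k, m1 (box (fun=> g k)) < +oo)%E ->
  (forall A, (forall i, measurable (A i)) -> m1 (box A) = m2 (box A)) ->
  forall B, measurable B -> m1 B = m2 B.
Proof.
move=> mg gT goo m12 B mB.
pose G : set (set Rd) :=
  [set B | exists2 A, (forall i, measurable (A i)) & B = box A].
apply: (measure_unique G (fun k => box (fun=> g k))) => //.
- apply/seteqP; split; last first.
    apply: smallest_sub; first exact: sigma_algebra_measurable.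
    by move=> _ [A mA ->]; exact: measurable_box.
  rewrite /measurable/=; apply: smallest_sub; first exact: smallest_sigma_algebra.
  rewrite -bigcup_seq => C [i _ [D mD <-]]; apply: sub_sigma_algebra.
  exists (fun j => if j == i then D else setT); first by move=> j; case: ifP.
  rewrite setTI; apply/seteqP; split=> t /=.
    by move=> Dt j; case: eqP => [->|].
  by move=> /(_ i); rewrite eqxx.
- move=> _ _ [A mA ->] [C mC ->]; exists (fun i => A i `&` C i).
    by move=> i; exact: measurableI.
  apply/seteqP; split => t /=; first by move=> [tA tC] i; split.
  by move=> tAC; split => i; have [] := tAC i.
- by move=> k; exists (fun=> g k).
- by move=> _ [A mA ->]; exact: m12.
Qed.

End boxes.

Section torus_geometry.
Context {R : realType} (d : nat).
Notation Rd := (Rn R d).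

(** The representative of [x - y] modulo the integer lattice lying in [torus]. *)
Definition torus_sub (x y : Rd) : Rd :=
  [tuple recenter (tnth x k - tnth y k) | k < d].

(** The infimum over the lattice is reached by reducing each coordinate of the
    difference to its smallest representative. *)
Lemma torus_dist_sub (x y : Rd) : torus_dist x y = enorm (torus_sub x y).
Proof.
rewrite /torus_dist; apply/eqP; rewrite eq_le; apply/andP; split.
  apply: ge_inf.
    by exists 0 => _ [z _ <-]; exact: sqrtr_ge0.
  exists [tuple Num.ceil (tnth x k - tnth y k - 1 / 2) | k < d] => //.
  congr Num.sqrt; apply: eq_bigr => k _.
  by rewrite !tnth_mktuple.
apply: lb_le_inf; first by exists (enorm [tuple tnth x k - tnth y k -
  (tnth [tuple (0 : int) | _ < d] k)%:~R | k < d]); exists [tuple 0 | _ < d].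
move=> _ [z _ <-]; rewrite ler_wsqrtr//; apply: ler_sum => k _.
by rewrite !tnth_mktuple; exact: recenter_sqr_min.
Qed.

Lemma torus_distC (x y : Rd) : torus_dist x y = torus_dist y x.
Proof.
congr inf; apply/seteqP; split=> _ [z _ <-];
  exists [tuple - tnth z k | k < d] => //; congr Num.sqrt;
  by apply: eq_bigr => k _; rewrite !tnth_mktuple intrN -sqrrN; congr (_ ^+ 2); ring.
Qed.

Lemma measurable_torus_sub :
  measurable_fun setT (fun p : Rd * Rd => torus_sub p.1 p.2).
Proof.
apply/measurable_fun_tnthP => k.
rewrite (_ : _ \o _ = recenter \o (fun p : Rd * Rd => tnth p.1 k - tnth p.2 k)); last first.
  by apply/funext => p /=; rewrite tnth_mktuple.
apply: measurableT_comp; first exact: measurable_recenter.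
by apply: measurable_funB; apply: (measurableT_comp (measurable_tnth k)).
Qed.

Lemma measurable_torus_subr (x : Rd) : measurable_fun setT (torus_sub x).
Proof.
exact: (measurableT_comp measurable_torus_sub (measurable_pair1 x)).
Qed.

Lemma measurable_enorm : measurable_fun setT (@enorm R d).
Proof.
apply: (measurableT_comp (f := @Num.sqrt R)).
  by apply: nondecreasing_measurable => // x y; exact: ler_wsqrtr.
apply: measurable_sum => k; apply: measurable_funX.
exact: measurable_tnth.
Qed.

Lemma torusE : torus R d = box (fun=> [set y | - (1 / 2) < y <= 1 / 2]).
Proof. by []. Qed.

Lemma measurable_half_open : measurable
  ([set y | - (1 / 2) < y <= 1 / 2] : set (measurableTypeR R)).
Proof. by rewrite (_ : [set y | _] = `]- (1 / 2), 1 / 2]%classic). Qed.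

Lemma measurable_torus : measurable (torus R d).
Proof. by rewrite torusE; apply: measurable_box => i; exact: measurable_half_open. Qed.

Lemma leb_box_lty (A : 'I_d -> set (measurableTypeR R)) :
  (forall i, measurable (A i)) ->
  (forall i, lebesgue_measure (A i) < +oo)%E -> (leb R d (box A) < +oo)%E.
Proof.
move=> mA Aoo; rewrite leb_box//.
suff /andP[] : (0 <= \prod_(i < d) lebesgue_measure (A i) < +oo)%E by [].
apply: (big_ind (fun z : \bar R => (0 <= z < +oo)%E)) => //.
- by rewrite lee01 ltry.
- move=> z w /andP[z0 zoo] /andP[w0 woo]; rewrite mule_ge0//=.
  by rewrite lte_mul_pinfty// ge0_fin_numE.
- by move=> i _; rewrite measure_ge0 Aoo.
Qed.


(** Homogeneity of the torus: [y |-> x - y] preserves the uniform law. On boxes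
    this is the one-dimensional statement, coordinate by coordinate. *)
Lemma leb_torus_sub (x : Rd) (A : set Rd) : measurable A ->
  leb R d (torus_sub x @^-1` A `&` torus R d) = leb R d (A `&` torus R d).
Proof.
pose m := mrestr (leb R d) measurable_torus.
move=> mA; apply: (@box_measure_unique _ _ (fun=> setT)
  (measure_function_pushforward__canonical__measure_function_Measure m
     (measurable_torus_subr x)) m) => //.
- by apply/seteqP; split => // t _; exists 0%N.
- move=> k; rewrite /= /pushforward /m /mrestr/= (_ : _ `&` _ = torus R d).
    rewrite torusE; apply: leb_box_lty => _; first exact: measurable_half_open.
    rewrite (_ : [set y | _] = `]- (1 / 2), 1 / 2]%classic)//.
    by rewrite lebesgue_measure_itv/=; case: ifP => // _; rewrite -EFinB ltry.
  by apply/seteqP; split => // t [].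
move=> B mB; rewrite /= /pushforward /m /mrestr.
pose I := [set y : measurableTypeR R | - (1 / 2) < y <= 1 / 2].
have -> : torus_sub x @^-1` box B `&` torus R d =
    box (fun i => [set y | B i (recenter (tnth x i - y))] `&` I).
  apply/seteqP; split => t /=.
    by move=> [tB tI] i; split; [have := tB i; rewrite tnth_mktuple|exact: tI].
  by move=> tB; split => i; have [+ +] := tB i; rewrite ?tnth_mktuple.
have -> : box B `&` torus R d = box (fun i => B i `&` I).
  apply/seteqP; split => t /=; first by move=> [tB tI] i; split; [exact: tB|exact: tI].
  by move=> tB; split => i; have [] := tB i.
have mI : measurable I by exact: measurable_half_open.
rewrite !leb_box.
- by apply: eq_bigr => i _; rewrite lebesgue_measure_recenter.
- by move=> i; exact: measurableI.
- move=> i; apply: measurableI => //.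
  have mf : measurable_fun [set: measurableTypeR R]
    (fun y : measurableTypeR R => recenter (tnth x i - y) : measurableTypeR R).
    by apply: (measurableT_comp measurable_recenter); exact: measurable_funB.
  by rewrite -[X in measurable X]setTI; exact: mf.
Qed.

Definition dilate (r : R) (x : Rd) : Rd := [tuple r * tnth x k | k < d].

Lemma measurable_dilate r : measurable_fun setT (dilate r).
Proof.
apply/measurable_fun_tnthP => k.
rewrite (_ : _ \o _ = fun x : Rd => r * tnth x k); last first.
  by apply/funext => p /=; rewrite tnth_mktuple.
by apply: measurable_funM => //; exact: measurable_tnth.
Qed.

Lemma enorm_dilate r x : 0 <= r -> enorm (dilate r x) = r * enorm x.
Proof.
move=> r0; rewrite /enorm; under eq_bigr do rewrite tnth_mktuple exprMn.
by rewrite -mulr_sumr sqrtrM ?sqr_ge0// sqrtr_sqr ger0_norm.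
Qed.

Lemma leb_dilate (r : R) (A : set Rd) : 0 < r -> measurable A ->
  leb R d (dilate r @^-1` A) = ((r^-1 ^+ d)%:E * leb R d A)%E.
Proof.
move=> r0 mA.
have rd0 : 0 <= r^-1 ^+ d by rewrite exprn_ge0// invr_ge0 ltW.
pose s : {nonneg R} := NngNum rd0.
pose g (k : nat) : set (measurableTypeR R) := `[- k%:R, k%:R]%classic.
apply/esym; apply: (@box_measure_unique _ _ g (mscale s (leb R d))
  (measure_function_pushforward__canonical__measure_function_Measure (leb R d)
     (measurable_dilate r))) => //.
- by move=> k; exact: measurable_itv.
- apply/seteqP; split => // t _.
  exists (\max_(i < d) (Num.truncn `|tnth t i|).+1)%N => // i.
  rewrite /g/= in_itv/= -ler_norml.
  rewrite (le_trans (ltW (truncnS_gt _)))// ler_nat.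
  exact: (leq_bigmax (F := fun i => (Num.truncn `|tnth t i|).+1)).
- move=> k; rewrite /mscale/= lte_mul_pinfty//; apply: leb_box_lty => i.
    exact: measurable_itv.
  by rewrite lebesgue_measure_itv/=; case: ifP => // _; rewrite -EFinB ltry.
move=> B mB; rewrite /mscale/= /pushforward.
have -> : dilate r @^-1` box B = box (fun i => (fun y => r * y) @^-1` B i).
  by apply/seteqP; split => t /= tB i; have := tB i; rewrite tnth_mktuple.
rewrite !leb_box//; last first.
  move=> i; rewrite -[X in measurable X]setTI.
  have mf : measurable_fun [set: measurableTypeR R]
    (fun y : measurableTypeR R => r * y : measurableTypeR R).
    exact: measurable_funM.
  exact: mf.
under [RHS]eq_bigr do rewrite lebesgue_measure_dilate//.
have prodV n : ((r^-1 ^+ n)%:E = \prod_(i < n) (r^-1)%:E :> \bar R)%E.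
  by elim: n => [|n IHn]; rewrite ?big_ord0// big_ord_recl -IHn exprS EFinM.
by rewrite big_split/=; congr (_ * _)%E; [exact: prodV|exact: leb_box].
Qed.

End torus_geometry.

(** * The mass of the connection function *)

Section connection_mass.
Context {R : realType} (d : nat).
Notation Rd := (Rn R d).

Lemma integral_torus_law (mu : {measure set Rd -> \bar R}) (x : Rd)
    (f : Rd -> \bar R) :
  (forall A, measurable A -> mu A = leb R d (A `&` torus R d)) ->
  measurable_fun setT f -> (forall y, 0 <= f y)%E ->
  (\int[mu]_y f (torus_sub x y) = \int[leb R d]_(y in torus R d) f y)%E.
Proof.
move=> muE mf f0.
have mT := @measurable_torus R d.
pose nu := measure_function_pushforward__canonical__measure_function_Measure mu
  (measurable_torus_subr x).
have nuE A : measurable A -> nu A = leb R d (A `&` torus R d).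
  move=> mA; rewrite /nu/= /pushforward muE ?leb_torus_sub//.
  by rewrite -[X in measurable X]setTI; exact: measurable_torus_subr.
transitivity (\int[nu]_y f y)%E.
  by rewrite [RHS](ge0_integral_pushforward (measurable_torus_subr x) mu measurableT).
have mTC : measurable (~` torus R d) by exact: measurableC.
rewrite (ge0_negligible_integral mTC)//; last by rewrite nuE// setICl measure0.
rewrite setTD setCK; apply: eq_measure_integral => A mA AT.
by rewrite nuE// setIidl.
Qed.

Variables (g : R -> R) (alpha : R).
Hypothesis g01 : forall t : R, 0 <= t -> 0 <= g t <= 1.
Hypothesis g_noninc : forall s t : R, 0 <= s -> s <= t -> g t <= g s.
Hypothesis alphaE : (\int[leb R d]_x (g (enorm x))%:E = alpha%:E)%E.

Lemma enorm_ge0 (x : Rd) : 0 <= enorm x. Proof. exact: sqrtr_ge0. Qed.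

(** [g] is monotone on the nonnegative half-line only; precomposing it with
    [Num.max 0] makes it monotone, hence measurable, on the whole line. *)
Lemma measurable_profile disp (T : measurableType disp) (f : T -> R) :
  measurable_fun setT f -> (forall x, 0 <= f x) -> measurable_fun setT (g \o f).
Proof.
move=> mf f0.
rewrite (_ : g \o f = (fun t => g (Num.max 0 t)) \o f); last first.
  by apply/funext => x /=; rewrite max_r.
apply: measurableT_comp => //; apply: nonincreasing_measurable => // s t st.
apply: g_noninc; first by rewrite le_max lexx.
by rewrite ge_max !le_max lexx/= st orbT.
Qed.

(** The probability that a given point of the torus is joined, at radius [r], to a
    uniform one. *)
Definition connection_mass (r : R) : \bar R :=
  (\int[leb R d]_(y in torus R d) (g (enorm y / r))%:E)%E.

Let phi (x : Rd) : \bar R := (g (enorm x))%:E.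

Let mphi : measurable_fun setT phi.
Proof.
apply/measurable_EFinP; apply: measurable_profile.
  exact: measurable_enorm.
exact: enorm_ge0.
Qed.

Let phi0 x : (0 <= phi x)%E.
Proof. by rewrite lee_fin; have /andP[] := g01 (enorm_ge0 x). Qed.

(** Rescaling the torus by [1 / r] turns the mass into an integral of the
    unscaled profile over an expanding box. *)
Lemma connection_mass_rescale r : 0 < r -> connection_mass r =
  ((r ^+ d)%:E * \int[leb R d]_(x in dilate r @^-1` torus R d) phi x)%E.
Proof.
move=> r0; have V0 : 0 < r^-1 by rewrite invr_gt0.
have mT := @measurable_torus R d.
have mD : measurable (dilate r @^-1` torus R d).
  by rewrite -[X in measurable X]setTI; exact: measurable_dilate.
pose nu := measure_function_pushforward__canonical__measure_function_Measure
  (leb R d) (@measurable_dilate R d r^-1).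
have rd0 : 0 <= r ^+ d by rewrite exprn_ge0// ltW.
pose s : {nonneg R} := NngNum rd0.
rewrite -(ge0_integral_mscale _ mD s)//; last by apply: measurable_funTS.
transitivity (\int[nu]_(x in dilate r @^-1` torus R d) phi x)%E.
  rewrite ge0_integral_pushforward//; last 2 first.
    exact: measurable_dilate.
    exact: measurable_funTS.
  rewrite -comp_preimage (_ : _ \o _ = id); last first.
    apply/funext => x; apply: eq_from_tnth => k /=.
    by rewrite !tnth_mktuple mulrA divff ?gt_eqF// mul1r.
  rewrite preimage_id; apply: eq_integral => x _.
  by rewrite /phi/= enorm_dilate 1?mulrC// ltW.
apply: eq_measure_integral => A mA _.
by rewrite /nu/= /pushforward leb_dilate// invrK.
Qed.

Lemma connection_mass_le r : 0 < r ->
  (connection_mass r <= (alpha * r ^+ d)%:E)%E.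
Proof.
move=> r0; rewrite connection_mass_rescale// mulrC EFinM -alphaE.
apply: lee_wpmul2l; first by rewrite lee_fin exprn_ge0// ltW.
apply: ge0_subset_integral => //.
by rewrite -[X in measurable X]setTI; apply: measurable_dilate => //; exact: measurable_torus.
Qed.

(** As [r] decreases to 0 the rescaled boxes exhaust the whole space. *)
Lemma connection_mass_ge beta : beta < alpha ->
  exists2 rho, 0 < rho & forall r, 0 < r <= rho ->
    ((beta * r ^+ d)%:E <= connection_mass r)%E.
Proof.
move=> ba.
pose F n := dilate (n.+1%:R^-1) @^-1` torus R d.
have FE n x : F n x <-> forall k, - (1 / 2) < n.+1%:R^-1 * tnth x k <= 1 / 2.
  by split => h k; have := h k; rewrite tnth_mktuple.
have mF n : measurable (F n).
  by rewrite -[X in measurable X]setTI; apply: measurable_dilate => //; exact: measurable_torus.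
have sub r r' x : 0 < r -> r <= r' -> torus R d (dilate r' x) ->
    torus R d (dilate r x).
  move=> r0 rr' h k; have := h k; rewrite !tnth_mktuple => /andP[h1 h2].
  by have [x0|x0] := leP 0 (tnth x k); apply/andP; split; nra.
have ndF : nondecreasing_seq F.
  move=> m n mn; rewrite subsetEset => x; apply: sub; first by rewrite invr_gt0.
  by rewrite lef_pV2 ?posrE// ler_nat.
have FT : \bigcup_n F n = setT.
  apply/seteqP; split => // x _.
  exists (\max_(i < d) (2 * (Num.truncn `|tnth x i|).+1))%N => //.
  apply/FE => k.
  set M := (\max_(i < d) _)%N.
  have M1 : 2 * `|tnth x k| < M.+1%:R.
    apply: (@lt_le_trans _ _ (2 * (Num.truncn `|tnth x k|).+1%:R)).
      by rewrite ltr_pM2l// truncnS_gt.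
    rewrite -natrM ler_nat leqW//.
    exact: (leq_bigmax (F := fun i => (2 * (Num.truncn `|tnth x i|).+1)%N)).
  have : `|M.+1%:R^-1 * tnth x k| < 1 / 2.
    rewrite normrM gtr0_norm ?invr_gt0// ltr_pdivrMl//.
    by move: M1; move: `|_| (M.+1%:R) => a b; lra.
  by rewrite ltr_norml => /andP[-> /ltW ->].
have cvgF := @ge0_nondecreasing_set_cvg_integral _ _ _ F phi (leb R d) ndF mF.
have {}cvgF : (\int[leb R d]_(x in F n) phi x @[n --> \oo] --> alpha%:E)%E.
  rewrite -alphaE -FT; apply: cvgF => //.
  by move=> i; exact: measurable_funTS.
have : \forall n \near \oo, (beta%:E < \int[leb R d]_(x in F n) phi x)%E.
  have ba' : (beta%:E < alpha%:E)%E by rewrite lte_fin.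
  exact: (cvgF _ (open_ereal_gt' ba')).
move=> [n _ /(_ n (leqnn _)) /= bn].
exists n.+1%:R^-1; first by rewrite invr_gt0.
move=> r /andP[r0 rn]; rewrite connection_mass_rescale// mulrC EFinM.
apply: lee_wpmul2l; first by rewrite lee_fin exprn_ge0// ltW.
apply: (le_trans (ltW bn)); apply: ge0_subset_integral => //.
- by rewrite -[X in measurable X]setTI; apply: measurable_dilate => //; exact: measurable_torus.
- exact: measurable_funTS.
- by move=> x; exact: sub.
Qed.

End connection_mass.

(** * Independence of one variable from all the others *)

Section independence_of_blocks.
Context {disp : measure_display} {Omega : measurableType disp} {R : realType}.
Variable P : probability Omega R.
Local Open Scope ereal_scope.

(** Two finite measures that agree on a pi-system agree on what it generates. *)
Lemma independent_g_sigma (G : set (set Omega)) (B : set Omega) :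
  G `<=` measurable -> setI_closed G -> G setT -> measurable B ->
  (forall A, G A -> P (A `&` B) = P A * P B) ->
  forall A, <<s G >> A -> P (A `&` B) = P A * P B.
Proof.
move=> Gm GI GT mB GB A sA.
pose s : {nonneg R} := NngNum (fine_ge0 (measure_ge0 P B)).
have sE : (s%:num)%:E = P B by rewrite fineK// fin_num_measure.
rewrite muleC -sE -[RHS]/(mscale s P A) -[LHS]/(mrestr P mB A).
apply: (g_sigma_algebra_measure_unique G Gm (fun=> setT)) => //.
- by apply/seteqP; split => // x _; exists 0%N.
- by move=> C GC; rewrite /= /mrestr GB// /mscale/= sE muleC.
- by move=> _; rewrite /= /mrestr setTI -ge0_fin_numE ?fin_num_measure.
Qed.

Context {I : choiceType}.
Variables (S : I -> set (set Omega)) (D : set I).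
Hypothesis Sm : forall i, S i `<=` measurable.
Hypothesis SI : forall i, setI_closed (S i).
Hypothesis ST : forall i, S i setT.
Hypothesis Sprod : forall (s : seq I) (A : I -> set Omega),
  uniq s -> [set` s] `<=` D -> (forall i, S i (A i)) ->
  P (\bigcap_(i in [set` s]) A i) = \prod_(i <- s) P (A i).

(** A pi-system that generates the sigma-algebra of all the members of the family
    but [a]. Taking all of them at once makes every expression without the
    variable [a] measurable for the same sigma-algebra. *)
Definition others (a : I) : set (set Omega) :=
  [set B | exists s : seq I, exists A : I -> set Omega,
    [/\ uniq s, [set` s] `<=` D, a \notin s, forall i, S i (A i) &
        B = \bigcap_(i in [set` s]) A i]].

Lemma others_measurable a : others a `<=` measurable.
Proof.
move=> _ [s [A [_ _ _ SA ->]]]; 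
by apply: fin_bigcap_measurable => // i _; exact: Sm.
Qed.

Lemma others_setI a : setI_closed (others a).
Proof.
move=> _ _ [s [A [us sD as_ SA ->]]] [t [B [ut tD at_ SB ->]]].
exists (undup (s ++ t)).
exists (fun i => (if i \in s then A i else setT) `&` (if i \in t then B i else setT)).
split.
- exact: undup_uniq.
- by move=> i /=; rewrite mem_undup mem_cat => /orP[/sD|/tD].
- by rewrite mem_undup mem_cat negb_or as_.
- by move=> i; apply: SI; case: ifP.
apply/seteqP; split => x.
  by move=> [xA xB] i _; split; case: ifP => // it; [exact: xA|exact: xB].
move=> xAB; split => i /= it.
  have [] := xAB i; first by rewrite /= mem_undup mem_cat it.
  by rewrite it.
have [] := xAB i; first by rewrite /= mem_undup mem_cat it orbT.
by rewrite it.
Qed.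

Lemma others_setT a : others a setT.
Proof.
exists [::], (fun=> setT); split => //.
by apply/seteqP; split.
Qed.

Lemma others_member a i A : D i -> i != a -> S i A -> <<s others a >> A.
Proof.
move=> Di ia SA; apply: sub_sigma_algebra.
exists [:: i], (fun j => if j == i then A else setT); split => //.
- by move=> j /=; rewrite inE => /eqP ->.
- by rewrite inE eq_sym.
- by move=> j; case: eqP => [->|].
apply/seteqP; split => x; first by move=> xA j /=; rewrite inE => ->.
by move/(_ i); rewrite /= inE eqxx; apply.
Qed.

Lemma independent_others a A B : D a -> <<s others a >> A -> S a B ->
  P (A `&` B) = P A * P B.
Proof.
move=> Da sA SB; apply: (independent_g_sigma (G := others a)) => //.
- exact: others_measurable.
- exact: others_setI.
- exact: others_setT.
- exact: Sm SB.
move=> _ [s [C [us sD as_ SC ->]]].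
pose C' i := if i == a then B else C i.
have SC' i : S i (C' i) by rewrite /C'; case: eqP => [->|].
have CC' : \prod_(i <- s) P (C' i) = \prod_(i <- s) P (C i).
  by apply: eq_big_seq => i is_; rewrite /C'; case: eqP => // ia; rewrite -ia is_ in as_.
have -> : \bigcap_(i in [set` s]) C i `&` B = \bigcap_(i in [set` a :: s]) C' i.
  apply/seteqP; split => x.
    move=> [xC xB] i /=; rewrite inE /C'; case: eqP => //= _ is_; exact: xC.
  move=> xC; split; last by have := xC a; rewrite /= inE eqxx /C' eqxx; apply.
  move=> i /= is_; have := xC i; rewrite /= inE is_ orbT /C'.
  by case: eqP => [ia|_]; [rewrite -ia is_ in as_|apply].
rewrite Sprod//=; last 2 first.
- by rewrite as_.
- by move=> i /=; rewrite inE => /orP[/eqP ->//|/sD].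
by rewrite big_cons CC' {1}/C' eqxx muleC Sprod.
Qed.

End independence_of_blocks.

Section integrating_out.
Context {disp : measure_display} {Omega : measurableType disp} {R : realType}.
Variable P : probability Omega R.
Context {d2 : measure_display} {T2 : measurableType d2}.
Variables (G : set (set Omega)) (Z : {mfun Omega >-> T2}).
Hypothesis Gm : G `<=` measurable.
Hypothesis indepZ : forall A B, <<s G >> A -> measurable B ->
  (P (A `&` Z @^-1` B) = P A * P (Z @^-1` B))%E.
Notation OmegaG := (g_sigma_algebraType G).

Lemma measurable_fun_coarse d (T : measurableType d) (Y : Omega -> T) :
  measurable_fun (setT : set OmegaG) Y -> measurable_fun (setT : set Omega) Y.
Proof.
move=> mY _ B mB; rewrite setTI.
have /= := mY measurableT B mB; rewrite setTI.
by apply: smallest_sub => //; exact: sigma_algebra_measurable.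
Qed.

(** The joint law of [Y] and [Z] is a product, so Tonelli applies. *)
Lemma integral_independent {d1} {T1 : measurableType d1} (Y : Omega -> T1) (f : T1 * T2 -> \bar R) :
  measurable_fun (setT : set OmegaG) Y ->
  measurable_fun setT f -> (forall z, 0 <= f z)%E ->
  (\int[P]_w f (Y w, Z w) = \int[P]_w \int[distribution P Z]_z f (Y w, z))%E.
Proof.
move=> mY mf f0.
have mY' := measurable_fun_coarse mY.
pose Y' : {mfun Omega >-> T1} := HB.pack Y (isMeasurableFun.Build _ _ _ _ _ mY').
have mYZ : measurable_fun setT (fun w => (Y w, Z w)).
  exact: measurable_fun_pair.
pose YZ : {mfun Omega >-> (T1 * T2)%type} := HB.pack (fun w => (Y w, Z w))
  (isMeasurableFun.Build _ _ _ _ _ mYZ).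
transitivity (\int[distribution P YZ]_z f z)%E.
  by rewrite ge0_integral_distribution.
transitivity (\int[distribution P Y' \x distribution P Z]_z f z)%E.
  apply: eq_measure_integral => A mA _; apply/esym; apply: product_measure_unique => //.
  move=> B C mB mC; rewrite /distribution/= /pushforward.
  apply: indepZ => //.
  by have := mY measurableT B mB; rewrite setTI.
rewrite fubini_tonelli1//.
rewrite [LHS](ge0_integral_distribution Y')//.
  exact: measurable_fun_fubini_tonelli_F.
by move=> y; apply: integral_ge0.
Qed.

(** The form in which one variable [Z] is integrated out of a product while the
    other factors, gathered in [t], stay put. *)
Lemma integral_independent_weight {d1} {T1 : measurableType d1}
    (Y : Omega -> T1) (t : Omega -> R) (f : T1 * T2 -> R) :
  measurable_fun (setT : set OmegaG) Y -> measurable_fun (setT : set OmegaG) t ->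
  measurable_fun setT f -> (forall z, 0 <= f z) -> (forall w, 0 <= t w) ->
  (\int[P]_w (t w * f (Y w, Z w))%:E =
   \int[P]_w ((t w)%:E * \int[distribution P Z]_z (f (Y w, z))%:E))%E.
Proof.
move=> mY mt mf f0 t0.
pose F (z : (R * T1) * T2) : \bar R := (`|z.1.1| * f (z.1.2, z.2))%:E.
have := @integral_independent _ _ (fun w => (t w, Y w) : (R * T1)%type) F.
have -> : (\int[P]_w F (t w, Y w, Z w) = \int[P]_w (t w * f (Y w, Z w))%:E)%E.
  by apply: eq_integral => w _; rewrite /F/= ger0_norm.
have -> : (\int[P]_w \int[distribution P Z]_z F (t w, Y w, z) =
    \int[P]_w ((t w)%:E * \int[distribution P Z]_z (f (Y w, z))%:E))%E.
  apply: eq_integral => w _; rewrite -ge0_integralZl_EFin//.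
  - by apply: eq_integral => z _; rewrite /F/= ger0_norm.
  - by move=> z _; rewrite lee_fin.
  - by apply/measurable_EFinP; exact: (measurableT_comp mf (measurable_pair1 _)).
apply.
- exact: measurable_fun_pair.
- apply/measurable_EFinP; apply: measurable_funM.
    by apply: measurableT_comp => //; exact: measurableT_comp.
  apply: measurableT_comp => //; apply: measurable_fun_pair => //.
  exact: measurableT_comp.
- by move=> z; rewrite lee_fin mulr_ge0.
Qed.

End integrating_out.

(** * Isolated points among independent points *)

Lemma indic_bool {T : Type} {R : pzRingType} (b : T -> bool) z :
  \1_[set x | b x] z = (b z)%:R :> R.
Proof.
rewrite indicE; suff -> : (z \in [set x | b x]) = b z by [].
by apply/idP/idP; rewrite inE.
Qed.

Lemma integral_prob_cst {d} {T : measurableType d} {R : realType}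
  (Q : probability T R) (c : R) : (\int[Q]_x c%:E = c%:E)%E.
Proof. by rewrite integral_cst// [X in (_ * X)%E]probability_setT mule1. Qed.

Lemma integral_bool {d} {T : measurableType d} {R : realType}
    (Q : probability T R) (b : T -> bool) : measurable [set x | b x] ->
  (\int[Q]_x (b x)%:R%:E = Q [set x | b x])%E.
Proof.
move=> mb; rewrite -[in RHS](setIT [set x | b x]) -integral_indic//.
by apply: eq_integral => x _; rewrite indic_bool.
Qed.

(** The bound of the second-moment method, solved for the probability [x]. *)
Lemma second_moment_bound {R : realFieldType} (n m : nat) (p x : R) :
  (0 < n <= m)%N -> 0 < p <= 1 / 2 ->
  let a := n%:R * (1 - p) ^+ m.-1 in
  a ^+ 2 * x + 2 * a ^+ 2 <=
    a + n%:R ^+ 2 * ((1 - p) ^+ (2 * m.-2) + p * (1 - p) ^+ m.-2) + a ^+ 2 ->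
  x <= (n%:R^-1 + p) / (1 - p) ^+ m + ((1 - p) ^- 2 - 1).
Proof.
move=> /andP[n0 nm] /andP[p0 p2] a main.
have b0 : 0 < 1 - p by lra.
have n0' : 0 < n%:R :> R by rewrite ltr0n.
have a20 : 0 < a ^+ 2 by rewrite !exprn_gt0// mulr_gt0// exprn_gt0.
rewrite -(ler_pM2l a20); set y := (X in _ <= _ * X).
pose kap := (1 - p) ^+ (2 * m.-2) + p * (1 - p) ^+ m.-2.
suff : a + n%:R ^+ 2 * kap - a ^+ 2 <= a ^+ 2 * y by move: main; rewrite -/kap; lra.
rewrite {main}/y /kap {a20 kap y}/a.
case: m nm => [|[|k]] /= nm; first by move: n0 nm; case: n {n0'}.
  have -> : n = 1%N by lia.
  rewrite muln0 !expr0 !expr1 expr1n invr1 mulr1.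
  have b1 : 1 <= (1 - p)^-1 by rewrite invf_ge1//; lra.
  rewrite -exprVn; move: (1 - p)^-1 b1 => c c1; nra.
rewrite mulnC exprM !exprS.
have B0 : 0 < (1 - p) ^+ k by exact: exprn_gt0.
move: ((1 - p) ^+ k) B0 => B B0.
set lhs := (X in X <= _); set rhs := (X in _ <= X).
suff : rhs - lhs = n%:R * B * p.
  have : 0 <= n%:R * B * p by rewrite !mulr_ge0// ltW.
  by lra.
by rewrite /lhs /rhs; field; rewrite !gt_eqF.
Qed.

Section random_connection_model.
Context {disp dT : measure_display} {Omega : measurableType disp}.
Context {T : measurableType dT} {R : realType} (P : probability Omega R).
Variables (X : nat -> {RV P >-> T}) (U : nat -> nat -> {RV P >-> R}).
Let ordered : set (nat * nat) := [set e | (e.1 < e.2)%N].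
Hypothesis X_indep : independent_family P setT (fun i w => X i w).
Hypothesis U_indep : independent_family P ordered (fun e w => U e.1 e.2 w).
Hypothesis XU_indep : forall A B,
  sigma_family setT (fun i w => X i w) A ->
  sigma_family ordered (fun e w => U e.1 e.2 w) B -> (P (A `&` B) = P A * P B)%E.
Variable mu : probability T R.
Hypothesis X_law : forall i A, measurable A -> distribution P (X i) A = mu A.
Hypothesis U_law : forall i j a, (i < j)%N -> 0 <= a <= 1 ->
  P (U i j @^-1` `]a, +oo[) = (1 - a)%:E.
Variables (h : T * T -> R) (p : R).
Hypothesis mh : measurable_fun setT h.
Hypothesis h01 : forall z, 0 <= h z <= 1.
Hypothesis hC : forall x y, h (x, y) = h (y, x).
Hypothesis h_mass : forall x, (\int[mu]_y (h (x, y))%:E = p%:E)%E.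

(** Positions and marks form one independent family, indexed by a sum. *)
Let K : choiceType := (nat + nat * nat)%type.
Let S (k : K) : set (set Omega) := match k with
  | inl i => preimage_set_system setT (X i) measurable
  | inr e => preimage_set_system setT (U e.1 e.2) measurable
  end.
Let D : set K := [set k | if k is inr e then (e.1 < e.2)%N else true].

Let S_measurable k : S k `<=` measurable.
Proof. by case: k => [i|e] _ [B mB <-]; exact: measurable_funP. Qed.

Let S_setI k : setI_closed (S k).
Proof.
by case: k => [i|e] _ _ [B mB <-] [C mC <-]; exists (B `&` C);
  rewrite ?preimage_setI ?setTI//; exact: measurableI.
Qed.

Let S_setT k : S k setT.
Proof. by case: k => [i|e]; exists setT; rewrite // preimage_setT setTI. Qed.

Let S_prod (s : seq K) (A : K -> set Omega) :
  uniq s -> [set` s] `<=` D -> (forall k, S k (A k)) ->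
  (P (\bigcap_(k in [set` s]) A k) = \prod_(k <- s) P (A k))%E.
Proof.
move=> us sD SA.
pose outl (k : K) := if k is inl i then Some i else None.
pose outr (k : K) := if k is inr e then Some e else None.
pose sX := pmap outl s; pose sU := pmap outr s.
have outlK : ocancel outl (@inl nat (nat * nat)) by case.
have outrK : ocancel outr (@inr nat (nat * nat)) by case.
have memX i : (i \in sX) = ((inl i : K) \in s).
  by rewrite /sX; elim: (s) => [|[i'|e'] s' IH] //=; rewrite !inE IH.
have memU e : (e \in sU) = ((inr e : K) \in s).
  by rewrite /sU; elim: (s) => [|[i'|e'] s' IH] //=; rewrite !inE IH.
have -> : \bigcap_(k in [set` s]) A k =
    \bigcap_(i in [set` sX]) A (inl i) `&` \bigcap_(e in [set` sU]) A (inr e).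
  apply/seteqP; split => w.
    by move=> wA; split => [i|e] /=; rewrite ?memX ?memU => /wA.
  by move=> [wX wU] [i|e] /= ks; [apply: wX; rewrite /= memX|apply: wU; rewrite /= memU].
have -> : (\prod_(k <- s) P (A k) =
    (\prod_(i <- sX) P (A (inl i))) * \prod_(e <- sU) P (A (inr e)))%E.
  rewrite /sX /sU; elim: (s) => [|[i|e] s' IH]; rewrite ?big_nil ?mule1//= !big_cons IH.
    by rewrite muleA.
  by rewrite muleCA.
have /choice[BX HX] i : exists B, measurable B /\ A (inl i) = X i @^-1` B.
  by have [B mB <-] := SA (inl i); exists B; rewrite setTI.
have /choice[BU HU] e : exists B, measurable B /\ A (inr e) = U e.1 e.2 @^-1` B.
  by have [B mB <-] := SA (inr e); exists B; rewrite setTI.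
have sUo : [set` sU] `<=` ordered by move=> e /=; rewrite memU => /sD.
rewrite XU_indep; first congr (_ * _)%E.
- rewrite (eq_bigcapr (fun i _ => (HX i).2)) X_indep//.
  + by apply: eq_bigr => i _; rewrite (HX i).2.
  + exact: pmap_uniq.
  + by move=> i; exact: (HX i).1.
- rewrite (eq_bigcapr (fun e _ => (HU e).2)) U_indep//.
  + by apply: eq_bigr => e _; rewrite (HU e).2.
  + exact: pmap_uniq.
  + by move=> e; exact: (HU e).1.
- apply: (@fin_bigcap_measurable _ (g_sigma_algebraType
    (\bigcup_(i in setT) preimage_set_system setT (X i) measurable))) => // i _.
  by apply: sub_sigma_algebra; exists i => //; exact: (SA (inl i)).
- apply: (@fin_bigcap_measurable _ (g_sigma_algebraType
    (\bigcup_(e in ordered) preimage_set_system setT (U e.1 e.2) measurable))) => // e es.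
  by apply: sub_sigma_algebra; exists e; [exact: sUo|exact: (SA (inr e))].
Qed.

Let G k := others S D k.
Let Om k := g_sigma_algebraType (G k).

Let G_measurable k : G k `<=` measurable.
Proof. exact: others_measurable. Qed.

Let measurable_X k i : inl i != k -> measurable_fun (setT : set (Om k)) (X i).
Proof.
move=> ik _ B mB; rewrite setTI; apply: (others_member S_setT _ ik) => //.
by exists B => //; rewrite setTI.
Qed.

Let measurable_U k i j : (i < j)%N -> inr (i, j) != k ->
  measurable_fun (setT : set (Om k)) (U i j).
Proof.
move=> ij ik _ B mB; rewrite setTI; apply: (others_member S_setT _ ik) => //.
by exists B => //; rewrite setTI.
Qed.

Let indep_X i A B : <<s G (inl i) >> A -> measurable B ->
  (P (A `&` X i @^-1` B) = P A * P (X i @^-1` B))%E.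
Proof.
move=> sA mB; apply: (independent_others S_measurable S_setI S_setT S_prod (a := inl i)) => //.
by exists B => //; rewrite setTI.
Qed.

Let indep_U i j A B : (i < j)%N -> <<s G (inr (i, j)) >> A -> measurable B ->
  (P (A `&` U i j @^-1` B) = P A * P (U i j @^-1` B))%E.
Proof.
move=> ij sA mB; apply: (independent_others S_measurable S_setI S_setT S_prod (a := inr (i, j))) => //.
by exists B => //; rewrite setTI.
Qed.

Definition edge (i j : nat) := (minn i j, maxn i j).

Definition nonadjacent (i j : nat) : set Omega :=
  [set w | h (X i w, X j w) < U (minn i j) (maxn i j) w].

Definition unjoined (i j : nat) : Omega -> R := \1_(nonadjacent i j).

Let hX i j (w : Omega) := h (X i w, X j w).

Let minmax i j : i != j -> (minn i j < maxn i j)%N.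
Proof. lia. Qed.

Let measurable_hX k i j : inl i != k -> inl j != k ->
  measurable_fun (setT : set (Om k)) (hX i j).
Proof.
move=> ik jk; apply: (measurableT_comp mh).
by apply: measurable_fun_pair; exact: measurable_X.
Qed.

Let measurable_unjoined k i j : i != j -> inl i != k -> inl j != k ->
  inr (edge i j) != k -> measurable_fun (setT : set (Om k)) (unjoined i j).
Proof.
move=> ij ik jk ek; apply: measurable_indic.
have mb : measurable_fun (setT : set (Om k))
    (fun w => hX i j w < U (minn i j) (maxn i j) w).
  apply: measurable_fun_ltr; first exact: measurable_hX.
  by apply: measurable_U => //; exact: minmax.
by have := mb measurableT [set true] I; rewrite setTI.
Qed.

Let unjoined_ge0 i j w : 0 <= unjoined i j w. Proof. by rewrite /unjoined indicE. Qed.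

(** The mark of a pair exceeds the level [hX i j] with probability [1 - hX i j],
    also in the presence of factors that do not involve this mark. *)
Lemma integrate_mark i j (t : Omega -> R) : i != j ->
  measurable_fun (setT : set (Om (inr (edge i j)))) t -> (forall w, 0 <= t w) ->
  (\int[P]_w (t w * unjoined i j w)%:E = \int[P]_w (t w * (1 - hX i j w))%:E)%E.
Proof.
move=> ij mt t0.
pose f (z : R * R) : R := ((z.1 < z.2)%R : bool)%:R.
have mf : measurable_fun setT f.
  rewrite (_ : f = \1_[set z | z.1 < z.2]); last first.
    by apply/funext => z; rewrite indic_bool.
  apply: measurable_indic.
  have mb : measurable_fun setT (fun z : R * R => z.1 < z.2) by exact: measurable_fun_ltr.
  by have := mb measurableT [set true] I; rewrite setTI.
have e1 : (\int[P]_w (t w * unjoined i j w)%:E =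
    \int[P]_w (t w * f (hX i j w, U (minn i j) (maxn i j) w))%:E)%E.
  by apply: eq_integral => w _; rewrite /unjoined indic_bool.
rewrite e1 (integral_independent_weight (G := G (inr (edge i j)))) //; last 2 first.
- by move=> A B sA mB; apply: indep_U => //; exact: minmax.
- exact: measurable_hX.
apply: eq_integral => w _; rewrite EFinM; congr (_ * _)%E.
rewrite -(U_law (minmax ij) (h01 _)).
rewrite -[RHS]/(distribution P (U (minn i j) (maxn i j)) `]hX i j w, +oo[%classic).
rewrite (_ : `]hX i j w, +oo[%classic = [set u | hX i j w < u]); last first.
  by apply/seteqP; split => u /=; rewrite in_itv/= andbT.
apply: integral_bool; rewrite (_ : [set u | _] = `]hX i j w, +oo[%classic).
  exact: measurable_itv.
by apply/seteqP; split => u /=; rewrite in_itv/= andbT.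
Qed.

Lemma integrate_position {d'} {T' : measurableType d'} j (Y : Omega -> T')
    (t : Omega -> R) (f : T' * T -> R) :
  measurable_fun (setT : set (Om (inl j))) Y ->
  measurable_fun (setT : set (Om (inl j))) t ->
  measurable_fun setT f -> (forall z, 0 <= f z) -> (forall w, 0 <= t w) ->
  (\int[P]_w (t w * f (Y w, X j w))%:E =
   \int[P]_w ((t w)%:E * \int[mu]_z (f (Y w, z))%:E))%E.
Proof.
move=> mY mt mf f0 t0.
rewrite (integral_independent_weight (G := G (inl j)))//; last by move=> A B; exact: indep_X.
apply: eq_integral => w _; congr (_ * _)%E; apply: eq_measure_integral => A mA _.
exact: X_law.
Qed.

Definition unjoined_all (i : nat) (J : seq nat) (w : Omega) : R :=
  \prod_(l <- J) unjoined i l w.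

Let unjoined_all_ge0 i J w : 0 <= unjoined_all i J w.
Proof. by apply: prodr_ge0. Qed.

Let measurable_unjoined_all k i J : inl i != k ->
  (forall l, l \in J -> [&& i != l, inl l != k & inr (edge i l) != k]) ->
  measurable_fun (setT : set (Om k)) (unjoined_all i J).
Proof.
move=> ik; elim: J => [|j J IH] HJ.
  rewrite (_ : unjoined_all i [::] = cst 1); first exact: measurable_cst.
  by apply/funext => w; rewrite /unjoined_all big_nil.
rewrite (_ : unjoined_all i (j :: J) = unjoined i j \* unjoined_all i J); last first.
  by apply/funext => w; rewrite /unjoined_all big_cons.
apply: measurable_funM.
  by have /and3P[? ? ?] := HJ j (mem_head _ _); exact: measurable_unjoined.
by apply: IH => l lJ; apply: HJ; rewrite inE lJ orbT.
Qed.

Let p01 : 0 <= p <= 1.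
Proof.
have x : T by exact: (X 0%N point).
have hp0 : (0 <= \int[mu]_y (h (x, y))%:E)%E.
  by apply: integral_ge0 => y _; rewrite lee_fin; have /andP[] := h01 (x, y).
have hp1 : (\int[mu]_y (h (x, y))%:E <= \int[mu]_y (cst 1%:E y))%E.
  apply: ge0_le_integral => //.
  - by move=> y _; rewrite lee_fin; have /andP[] := h01 (x, y).
  - by apply/measurable_EFinP; exact: (measurableT_comp mh (measurable_pair1 _)).
  - by move=> y _; rewrite lee_fin; have /andP[] := h01 (x, y).
move: hp0 hp1; rewrite h_mass integral_prob_cst !lee_fin.
by move=> -> ->.
Qed.

Let mass_compl x : (\int[mu]_z (1 - h (x, z))%:E = (1 - p)%:E)%E.
Proof.
have mhx : measurable_fun setT (fun z => h (x, z)).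
  exact: (measurableT_comp mh (measurable_pair1 _)).
have : (\int[mu]_z ((1 - h (x, z))%:E + (h (x, z))%:E) = 1)%E.
  transitivity (\int[mu]_z (cst 1%:E z))%E.
    by apply: eq_integral => z _; rewrite -EFinD subrK.
  exact: integral_prob_cst.
rewrite ge0_integralD//.
- rewrite h_mass => e; have := congr1 (fun u => u - p%:E)%E e.
  by rewrite addeK.
- by move=> z _; rewrite lee_fin subr_ge0; have /andP[] := h01 (x, z).
- by apply/measurable_EFinP; apply: measurable_funB.
- by move=> z _; rewrite lee_fin; have /andP[] := h01 (x, z).
- exact/measurable_EFinP.
Qed.

(** Each further point multiplies the probability by [1 - p]: its mark and then its
    position are integrated out, and [h_mass] holds at every position of [i]. *)
Lemma mean_unjoined_all i J : uniq J -> i \notin J ->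
  (\int[P]_w (unjoined_all i J w)%:E = ((1 - p) ^+ size J)%:E)%E.
Proof.
elim: J => [|j J IH] /= uJ iJ.
  under eq_integral do rewrite /unjoined_all big_nil.
  exact: integral_prob_cst.
move: uJ iJ; rewrite inE negb_or => /andP[jJ uJ] /andP[ij iJ].
have ji : j != i by rewrite eq_sym.
have lJ l : l \in J -> [/\ i != l, l != j & edge i l != edge i j].
  move=> lJ; have il : i != l by apply: contraNneq iJ => ->.
  have lj : l != j by apply: contraNneq jJ => <-.
  by split => //; apply/eqP => -[]; lia.
transitivity (\int[P]_w (unjoined_all i J w * unjoined i j w)%:E)%E.
  by apply: eq_integral => w _; rewrite /unjoined_all big_cons mulrC.
rewrite integrate_mark//; last first.
  by apply: measurable_unjoined_all => // l /lJ[-> _ lj] /=.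
rewrite (@integrate_position _ _ j (X i) _ (fun z => 1 - h z))//.
- transitivity (\int[P]_w ((1 - p)%:E * (unjoined_all i J w)%:E))%E.
    by apply: eq_integral => w _; rewrite mass_compl muleC.
  rewrite ge0_integralZl_EFin//.
  + by rewrite IH// -EFinM exprS.
  + by move=> w _; rewrite lee_fin.
  + apply/measurable_EFinP.
    apply: (measurable_fun_coarse (G := G (inl j))); first exact: G_measurable.
    by apply: measurable_unjoined_all => // l /lJ[-> lj _] /=; rewrite andbT.
  + by rewrite subr_ge0; case/andP: p01.
- exact: measurable_X.
- by apply: measurable_unjoined_all => // l /lJ[-> lj _] /=; rewrite andbT.
- exact: measurable_funB.
- by move=> z; rewrite subr_ge0; case/andP: (h01 z).
Qed.

(** The mass shared by the neighbourhoods of two points. *)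
Definition overlap (x y : T) : R := fine (\int[mu]_z (h (x, z) * h (y, z))%:E)%E.

Let mhh x y : measurable_fun setT (fun z => h (x, z) * h (y, z)).
Proof.
by apply: measurable_funM; exact: (measurableT_comp mh (measurable_pair1 _)).
Qed.

Let h_ge0 z : 0 <= h z. Proof. by case/andP: (h01 z). Qed.
Let h_le1 z : h z <= 1. Proof. by case/andP: (h01 z). Qed.

Let overlap_le_mass x y : (\int[mu]_z (h (x, z) * h (y, z))%:E <= p%:E)%E.
Proof.
rewrite -(h_mass x); apply: ge0_le_integral => //.
- by move=> z _; rewrite lee_fin mulr_ge0.
- exact/measurable_EFinP.
- by apply/measurable_EFinP; exact: (measurableT_comp mh (measurable_pair1 _)).
- by move=> z _; rewrite lee_fin ler_piMr.
Qed.

Let overlapE x y : (\int[mu]_z (h (x, z) * h (y, z))%:E = (overlap x y)%:E)%E.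
Proof.
rewrite /overlap fineK// ge0_fin_numE; last first.
  by apply: integral_ge0 => z _; rewrite lee_fin mulr_ge0.
by apply: le_lt_trans (overlap_le_mass x y) _; exact: ltry.
Qed.

Let overlap_itv x y : 0 <= overlap x y <= p.
Proof.
rewrite -!lee_fin -overlapE overlap_le_mass andbT.
by apply: integral_ge0 => z _; rewrite lee_fin mulr_ge0.
Qed.

Let measurable_overlap : measurable_fun setT (fun z : T * T => overlap z.1 z.2).
Proof.
rewrite (_ : (fun z => _) = fine \o
    (fun z : T * T => \int[mu]_y (h (z.1, y) * h (z.2, y))%:E)%E) //.
apply: measurableT_comp => //.
apply: (@measurable_fun_fubini_tonelli_F _ _ _ _ _ mu
  (fun zy : (T * T) * T => (h (zy.1.1, zy.2) * h (zy.1.2, zy.2))%:E)).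
- apply/measurable_EFinP; apply: measurable_funM; apply: (measurableT_comp mh);
    apply: measurable_fun_pair => //; exact: measurableT_comp.
- by move=> z; rewrite lee_fin mulr_ge0.
Qed.

(** Probability that a fresh point is adjacent to neither [x] nor [y]. *)
Definition avoid (x y : T) : R := 1 - 2 * p + overlap x y.

Let avoidE x y :
  (\int[mu]_z ((1 - h (x, z)) * (1 - h (y, z)))%:E = (avoid x y)%:E)%E.
Proof.
have m1 : measurable_fun setT (fun z => h (x, z)).
  exact: (measurableT_comp mh (measurable_pair1 _)).
have m2 : measurable_fun setT (fun z => h (y, z)).
  exact: (measurableT_comp mh (measurable_pair1 _)).
have m3 : measurable_fun setT (fun z => (1 - h (x, z)) * (1 - h (y, z))).
  by apply: measurable_funM; apply: measurable_funB.
have h0 u z : 0 <= h (u, z) by case/andP: (h01 (u, z)).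
have c0 z : 0 <= (1 - h (x, z)) * (1 - h (y, z)).
  by rewrite mulr_ge0// subr_ge0; [case/andP: (h01 (x, z))|case/andP: (h01 (y, z))].
have : (\int[mu]_z (((1 - h (x, z)) * (1 - h (y, z)))%:E + ((h (x, z))%:E + (h (y, z))%:E)) =
    \int[mu]_z (1%:E + (h (x, z) * h (y, z))%:E))%E.
  by apply: eq_integral => z _; rewrite -!EFinD; congr EFin; ring.
rewrite !ge0_integralD//.
- rewrite !h_mass overlapE integral_prob_cst -!EFinD => e.
  have {}e := congr1 (fun u => u - (p + p)%:E)%E e.
  move: e; rewrite addeK// -EFinB => ->; congr EFin; rewrite /avoid; ring.
all: try by move=> z _; rewrite ?adde_ge0 ?lee_fin ?c0 ?mulr_ge0 ?h0.
all: try exact/measurable_EFinP.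
by apply: emeasurable_funD; exact/measurable_EFinP.
Qed.

Let measurable_avoid : measurable_fun setT (fun z : T * T => avoid z.1 z.2).
Proof. by apply: measurable_funD => //; exact: measurable_cst. Qed.

Let avoid_ge0 x y : 0 <= avoid x y.
Proof.
rewrite -lee_fin -avoidE; apply: integral_ge0 => z _.
by rewrite lee_fin mulr_ge0// subr_ge0.
Qed.

Let measurable_XX k i j : inl i != k -> inl j != k ->
  measurable_fun (setT : set (Om k)) (fun w => (X i w, X j w)).
Proof. by move=> ik jk; apply: measurable_fun_pair; exact: measurable_X. Qed.

(** As for a single point, but what a further point contributes now depends on the
    two positions; the weight [psi] collects these contributions along the
    induction. *)
Lemma mean_unjoined_pair i i' J (psi : T * T -> R) : i != i' -> uniq J ->
  i \notin J -> i' \notin J ->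
  measurable_fun setT psi -> (forall z, 0 <= psi z) ->
  (\int[P]_w (psi (X i w, X i' w) * (unjoined_all i J w * unjoined_all i' J w))%:E =
   \int[P]_w (psi (X i w, X i' w) * avoid (X i w) (X i' w) ^+ size J)%:E)%E.
Proof.
move=> ii'; elim: J psi => [|j J IH] psi /= uJ iJ i'J mpsi psi0.
  by apply: eq_integral => w _; rewrite /unjoined_all !big_nil mul1r expr0.
move: uJ iJ i'J; rewrite !inE !negb_or => /andP[jJ uJ] /andP[ij iJ] /andP[i'j i'J].
have lJ l : l \in J -> [/\ i != l, i' != l & l != j].
  move=> lJ; split; [by apply: contraNneq iJ => ->|by apply: contraNneq i'J => ->|].
  by apply: contraNneq jJ => <-.
have mpsiX k : inl i != k -> inl i' != k ->
    measurable_fun (setT : set (Om k)) (fun w => psi (X i w, X i' w)).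
  by move=> ik i'k; apply: (measurableT_comp mpsi); exact: measurable_XX.
have mprod k : inl i != k -> inl i' != k ->
    (forall l, l \in J -> [&& inl l != k, inr (edge i l) != k & inr (edge i' l) != k]) ->
    measurable_fun (setT : set (Om k))
      (fun w => psi (X i w, X i' w) * (unjoined_all i J w * unjoined_all i' J w)).
  move=> ik i'k HJ; apply: measurable_funM; first exact: mpsiX.
  by apply: measurable_funM; apply: measurable_unjoined_all => // l lJ';
    have /and3P[a b c] := HJ l lJ'; have [d e f] := lJ l lJ'; apply/and3P.
have prod_ge0 w : 0 <= psi (X i w, X i' w) * (unjoined_all i J w * unjoined_all i' J w).
  by rewrite !mulr_ge0.
transitivity (\int[P]_w (psi (X i w, X i' w) * (unjoined_all i J w * unjoined_all i' J w) *
    unjoined i j w * unjoined i' j w)%:E)%E.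
  by apply: eq_integral => w _; rewrite /unjoined_all !big_cons; congr EFin; ring.
rewrite integrate_mark//; last 2 first.
- apply: measurable_funM.
    apply: mprod => // l /lJ[il i'l lj] /=.
    by apply/andP; split; apply/eqP => -[]; lia.
  apply: measurable_unjoined => //=.
  by apply/eqP => -[]; lia.
- by move=> w; rewrite mulr_ge0.
transitivity (\int[P]_w (psi (X i w, X i' w) * (unjoined_all i J w * unjoined_all i' J w) *
    (1 - hX i' j w) * unjoined i j w)%:E)%E.
  by apply: eq_integral => w _; congr EFin; ring.
rewrite integrate_mark//; last 2 first.
- apply: measurable_funM.
    apply: mprod => // l /lJ[il i'l lj] /=.
    by apply/andP; split; apply/eqP => -[]; lia.
  by apply: measurable_funB => //; exact: measurable_hX.
- by move=> w; rewrite mulr_ge0// subr_ge0; exact: h_le1.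
pose f (z : (T * T) * T) := (1 - h (z.1.1, z.2)) * (1 - h (z.1.2, z.2)).
transitivity (\int[P]_w (psi (X i w, X i' w) * (unjoined_all i J w * unjoined_all i' J w) *
    f ((X i w, X i' w), X j w))%:E)%E.
  by apply: eq_integral => w _; congr EFin; rewrite /f /= /hX; ring.
have mhfst : measurable_fun setT (fun z : (T * T) * T => h (z.1.1, z.2)).
  apply: (measurableT_comp mh); apply: measurable_fun_pair => //; exact: measurableT_comp.
have mhsnd : measurable_fun setT (fun z : (T * T) * T => h (z.1.2, z.2)).
  apply: (measurableT_comp mh); apply: measurable_fun_pair => //; exact: measurableT_comp.
rewrite integrate_position//; last 4 first.
- exact: measurable_XX.
- by apply: mprod => // l /lJ[il i'l lj]; rewrite /= andbT.
- by apply: measurable_funM; apply: measurable_funB.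
- by move=> z; rewrite mulr_ge0// subr_ge0.
pose psi' z := psi z * avoid z.1 z.2.
transitivity (\int[P]_w (psi' (X i w, X i' w) * (unjoined_all i J w * unjoined_all i' J w))%:E)%E.
  apply: eq_integral => w _; rewrite avoidE -EFinM; congr EFin; rewrite /psi'/=; ring.
rewrite IH//; last 2 first.
- exact: measurable_funM.
- by move=> z; rewrite mulr_ge0.
by apply: eq_integral => w _; rewrite /psi'/= exprS mulrA.
Qed.

(** Integrating a common neighbour out of [h x z * h y z] leaves the overlap;
    integrating [x], [y] and [z] out in turn leaves [p ^+ 2]. *)
Lemma mean_overlap i i' : i != i' ->
  (\int[P]_w (overlap (X i w) (X i' w))%:E = (p ^+ 2)%:E)%E.
Proof.
move=> ii'; pose k := (i + i').+1.
have ik : i != k by rewrite /k; lia.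
have i'k : i' != k by rewrite /k; lia.
have mhfst : measurable_fun setT (fun z : (T * T) * T => h (z.1.1, z.2)).
  apply: (measurableT_comp mh); apply: measurable_fun_pair => //; exact: measurableT_comp.
have mhsnd : measurable_fun setT (fun z : (T * T) * T => h (z.1.2, z.2)).
  apply: (measurableT_comp mh); apply: measurable_fun_pair => //; exact: measurableT_comp.
have m1 a : measurable_fun (setT : set (Om a)) (fun=> 1 : R) by exact: measurable_cst.
pose f (z : (T * T) * T) := h (z.1.1, z.2) * h (z.1.2, z.2).
pose f' (z : (T * T) * T) := h (z.1.1, z.2) * h (z.1.1, z.1.2).
transitivity (\int[P]_w (1 * f ((X i w, X i' w), X k w))%:E)%E.
  rewrite integrate_position//; last 3 first.
  - exact: measurable_XX.
  - exact: measurable_funM.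
  - by move=> z; rewrite mulr_ge0.
  by apply: eq_integral => w _; rewrite overlapE mul1e.
transitivity (\int[P]_w (1 * f' ((X k w, X i' w), X i w))%:E)%E.
  by apply: eq_integral => w _; rewrite /f /f'/= (hC (X i w)) (hC (X i' w)).
rewrite integrate_position//; last 3 first.
- by apply: measurable_XX; rewrite eq_sym.
- apply: measurable_funM; first exact: mhfst.
  apply: (measurableT_comp mh); apply: measurable_fun_pair; exact: measurableT_comp.
- by move=> z; rewrite mulr_ge0.
transitivity (\int[P]_w (p%:E * (1 * h (X i' w, X k w))%:E))%E.
  apply: eq_integral => w _; rewrite mul1e /f' /=.
  rewrite (hC (X i' w)) mul1r; under eq_integral do rewrite mulrC.
  under eq_integral do rewrite EFinM.
  rewrite ge0_integralZl_EFin//.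
  - by rewrite h_mass muleC.
  - by move=> z _; rewrite lee_fin.
  - by apply/measurable_EFinP; exact: (measurableT_comp mh (measurable_pair1 _)).
rewrite ge0_integralZl_EFin//; last 3 first.
- by move=> w _; rewrite lee_fin mul1r.
- apply/measurable_EFinP; apply: measurable_funM => //.
  by apply: (measurableT_comp mh); exact: measurable_fun_pair.
- by case/andP: p01.
rewrite (@integrate_position _ _ k (X i') (fun=> 1) h)//; last exact: measurable_X.
under eq_integral do rewrite h_mass mul1e.
by rewrite integral_prob_cst -EFinM expr2.
Qed.

(** Convexity of the power function, along the chord from [a] to [b]. *)
Lemma expr_chord_le (a b s : R) n : 0 <= a <= b -> 0 <= s <= 1 ->
  (a + s * (b - a)) ^+ n <= (1 - s) * a ^+ n + s * b ^+ n.
Proof.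
move=> /andP[a0 ab] /andP[s0 s1]; elim: n => [|n IH]; first by rewrite !expr0; lra.
have c0 : 0 <= a + s * (b - a) by rewrite addr_ge0// mulr_ge0// subr_ge0.
rewrite !exprS; apply: le_trans (ler_wpM2l c0 IH) _.
have an : 0 <= a ^+ n by exact: exprn_ge0.
have abn : a ^+ n <= b ^+ n by rewrite lerXn2r// nnegrE// (le_trans a0).
move: (a ^+ n) (b ^+ n) an abn => A B A0 AB.
have : 0 <= s * (1 - s) * (b - a) * (B - A) by rewrite !mulr_ge0// subr_ge0.
lra.
Qed.

(** [avoid] divides the segment from [1 - 2 * p] to [1 - p] in the ratio
    [overlap / p], and [1 - 2 * p <= (1 - p) ^+ 2]: the chord inequality is linear
    in the overlap, whose mean is [p ^+ 2]. *)
Lemma mean_unjoined_pair_le i i' J : i != i' -> uniq J -> i \notin J -> i' \notin J ->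
  0 < p <= 1 / 2 ->
  (\int[P]_w (unjoined_all i J w * unjoined_all i' J w)%:E <=
   ((1 - p) ^+ (2 * size J) + p * (1 - p) ^+ size J)%:E)%E.
Proof.
move=> ii' uJ iJ i'J /andP[p0 p2].
have mcst : measurable_fun setT (fun _ : T * T => 1 : R) by exact: measurable_cst.
have := mean_unjoined_pair ii' uJ iJ i'J mcst (fun=> ler01).
under eq_integral do rewrite mul1r.
under [in RHS]eq_integral do rewrite mul1r.
move=> ->; set n := size J.
have mXX : measurable_fun setT (fun w => (X i w, X i' w)) by exact: measurable_fun_pair.
apply: (@le_trans _ _ (\int[P]_w (((1 - p) ^+ (2 * n))%:E +
    ((1 - p) ^+ n / p)%:E * (overlap (X i w) (X i' w))%:E))%E).
  apply: ge0_le_integral => //.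
  - by move=> w _; rewrite lee_fin exprn_ge0.
  - apply/measurable_EFinP; apply: measurable_funX.
    exact: (measurableT_comp measurable_avoid mXX).
  - apply/measurable_EFinP; apply: measurable_funD => //.
    apply: measurable_funM => //.
    exact: (measurableT_comp measurable_overlap mXX).
  move=> w _; rewrite -EFinM -EFinD lee_fin.
  have /andP[q0 qp] := overlap_itv (X i w) (X i' w).
  pose s := overlap (X i w) (X i' w) / p.
  have s01 : 0 <= s <= 1 by rewrite /s divr_ge0 ?ler_pdivrMr ?mul1r ?qp// ltW.
  have -> : avoid (X i w) (X i' w) = (1 - 2 * p) + s * ((1 - p) - (1 - 2 * p)).
    rewrite /avoid /s; field; lra.
  apply: le_trans (expr_chord_le n _ s01) _; first by lra.
  have -> : (1 - p) ^+ n / p * overlap (X i w) (X i' w) = s * (1 - p) ^+ n.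
    by rewrite /s; ring.
  apply: lerD => //; rewrite exprM.
  have a0 : 0 <= (1 - 2 * p) ^+ n by apply: exprn_ge0; lra.
  apply: (@le_trans _ _ ((1 - 2 * p) ^+ n)).
    by rewrite ler_piMl//; case/andP: s01; lra.
  by rewrite lerXn2r ?nnegrE; nra.
rewrite ge0_integralD//.
- rewrite integral_prob_cst ge0_integralZl_EFin//.
  + rewrite mean_overlap// -EFinM -EFinD lee_fin lerD2l expr2 mulrA.
    by rewrite divfK ?gt_eqF// mulrC.
  + by move=> w _; rewrite lee_fin; case/andP: (overlap_itv (X i w) (X i' w)).
  + by apply/measurable_EFinP; exact: (measurableT_comp measurable_overlap mXX).
  + by rewrite divr_ge0 ?exprn_ge0 ?ltW//; lra.
- by move=> w _; rewrite lee_fin exprn_ge0//; lra.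
- move=> w _; rewrite -EFinM lee_fin mulr_ge0//; last by case/andP: (overlap_itv (X i w) (X i' w)).
  by rewrite divr_ge0 ?exprn_ge0 ?ltW//; lra.
- apply: emeasurable_funM => //.
  by apply/measurable_EFinP; exact: (measurableT_comp measurable_overlap mXX).
Qed.

Let measurable_nonadjacent i j : i != j -> measurable (nonadjacent i j).
Proof.
move=> ij.
have mb : measurable_fun setT (fun w => hX i j w < U (minn i j) (maxn i j) w).
  apply: measurable_fun_ltr => //; apply: (measurableT_comp mh).
  exact: measurable_fun_pair.
by have := mb measurableT [set true] I; rewrite setTI.
Qed.

(** Whether or not it is one of the first [m] points, [i] is joined to no other one
    of them. *)
Definition isolated_among (i m : nat) : set Omega :=
  [set w | forall j, (j < m)%N -> j != i -> nonadjacent i j w].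

Let rest i m := rem i (iota 0 m).

Let uniq_rest i m : uniq (rest i m).
Proof. by rewrite rem_uniq// iota_uniq. Qed.

Let mem_rest i m j : (j \in rest i m) = (j != i) && (j < m)%N.
Proof. by rewrite (mem_rem_uniq _ (iota_uniq _ _)) !inE mem_iota. Qed.

Let size_rest i m : (m.-1 <= size (rest i m))%N.
Proof.
have [im|im] := boolP (i \in iota 0 m); first by rewrite size_rem// size_iota.
by rewrite /rest rem_id// size_iota leq_pred.
Qed.

Let isolatedE i m : isolated_among i m =
  \bigcap_(j in [set` rest i m]) nonadjacent i j.
Proof.
apply/seteqP; split => w iw j.
  by rewrite /= mem_rest => /andP[ji jm]; exact: iw.
by move=> jm ji; apply: iw; rewrite /= mem_rest ji.
Qed.

Lemma measurable_isolated_among i m : measurable (isolated_among i m).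
Proof.
rewrite isolatedE; apply: fin_bigcap_measurable => // j /=.
by rewrite mem_rest eq_sym => /andP[? _]; exact: measurable_nonadjacent.
Qed.

Let unjoined_allE i J w :
  unjoined_all i J w = \1_(\bigcap_(j in [set` J]) nonadjacent i j) w.
Proof.
elim: J => [|j J IH].
  by rewrite /unjoined_all big_nil indicE mem_set// => j.
rewrite /unjoined_all big_cons -/(unjoined_all i J w) IH /unjoined.
rewrite -[LHS]/((\1_(nonadjacent i j) \* \1_(\bigcap_(l in [set` J]) nonadjacent i l)) w).
rewrite -indicI; congr (\1_(_) w); apply/seteqP; split => v.
  by move=> [vj vJ] l /=; rewrite inE => /orP[/eqP ->//|]; exact: vJ.
by move=> vJ; split => [|l lJ]; apply: vJ; rewrite /= inE ?eqxx// lJ orbT.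
Qed.

Let unjoined_all_le i J J' w : {subset J' <= J} -> unjoined_all i J w <= unjoined_all i J' w.
Proof.
move=> JJ; rewrite !unjoined_allE !indicE ler_nat.
case: (boolP (w \in _)) => //; rewrite inE => wJ.
by rewrite mem_set// => j /= /JJ; exact: wJ.
Qed.

Let measurable_unjoined_allT i J : i \notin J -> measurable_fun setT (unjoined_all i J).
Proof.
move=> iJ; rewrite (_ : unjoined_all i J = \1_(\bigcap_(j in [set` J]) nonadjacent i j)).
  apply: measurable_indic; apply: fin_bigcap_measurable => // j /= jJ.
  by apply: measurable_nonadjacent; apply: contraNneq iJ => ->.
by apply/funext => w; rewrite unjoined_allE.
Qed.

Let i_rest i m : i \notin rest i m.
Proof. by rewrite mem_rest eqxx. Qed.

Let prob_isolated i m :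
  (P (isolated_among i m) = ((1 - p) ^+ size (rest i m))%:E)%E.
Proof.
rewrite -(mean_unjoined_all (uniq_rest i m) (i_rest i m)).
under eq_integral do rewrite unjoined_allE -isolatedE.
by rewrite integral_indic ?setIT//; exact: measurable_isolated_among.
Qed.

(** Union bound; [m.-1] because a point is not counted among its neighbours. *)
Lemma prob_some_isolated_le (n m : nat) :
  (P [set w | exists2 i, (i < n)%N & isolated_among i m w] <=
   (n%:R * (1 - p) ^+ m.-1)%:E)%E.
Proof.
have /andP[p0 p1] := p01.
rewrite (_ : [set w | _] = \big[setU/set0]_(i < n) isolated_among i m).
  apply: (le_trans (@Boole_inequality _ _ _ P (isolated_among ^~ m) n
    (fun i _ => measurable_isolated_among i m))).
  apply: (@le_trans _ _ (\sum_(i < n) ((1 - p) ^+ m.-1)%:E)%E).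
    apply: lee_sum => i _; rewrite /= prob_isolated lee_fin.
    by rewrite ler_wiXn2l ?size_rest//; lra.
  by rewrite sumEFin sumr_const card_ord -[_ *+ n]mulr_natl.
rewrite -(bigcup_mkord n (isolated_among ^~ m)); apply/seteqP; split => w.
  by move=> [i ilt iw]; exists i.
by move=> [i ilt iw]; exists i.
Qed.

Let integral_sumR (n : nat) (f : 'I_n -> Omega -> R) :
  (forall i, measurable_fun setT (f i)) -> (forall i w, 0 <= f i w) ->
  (\int[P]_w (\sum_(i < n) f i w)%:E = \sum_(i < n) \int[P]_w (f i w)%:E)%E.
Proof.
move=> mf f0; under eq_integral do rewrite -sumEFin.
rewrite ge0_integral_sum//.
- by move=> i; exact/measurable_EFinP.
- by move=> i w _; rewrite lee_fin.
Qed.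

(** Second-moment method for the number [V] of isolated points: pointwise
    [a ^+ 2 * \1_(V = 0) + 2 * a * V <= V ^+ 2 + a ^+ 2], to be integrated with
    [a] the mean of [V]. *)
Lemma prob_none_isolated_le (n m : nat) : (0 < n <= m)%N -> 0 < p <= 1 / 2 ->
  (P [set w | forall i, (i < n)%N -> ~ isolated_among i m w] <=
   ((n%:R^-1 + p) / (1 - p) ^+ m + ((1 - p) ^- 2 - 1))%:E)%E.
Proof.
move=> /andP[n0 nm] p02; set A := [set w | _]; have /andP[p0 p2] := p02.
have b0 : 0 < 1 - p by lra.
pose pi1 := (1 - p) ^+ m.-1; pose a := n%:R * pi1.
pose kap := (1 - p) ^+ (2 * m.-2) + p * (1 - p) ^+ m.-2.
pose F (i : 'I_n) w := unjoined_all i (rest i m) w.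
pose V w := \sum_(i < n) F i w.
have im (i : 'I_n) : (i < m)%N by exact: leq_trans nm.
have szr (i : 'I_n) : size (rest i m) = m.-1.
  by rewrite size_rem ?size_iota// mem_iota/= add0n im.
have mF i : measurable_fun setT (F i) by exact: measurable_unjoined_allT.
have F0 i w : 0 <= F i w by exact: unjoined_all_ge0.
have mA : measurable A.
  rewrite (_ : A = \bigcap_(i in [set k | (k < n)%N]) ~` isolated_among i m)//.
  apply: bigcap_measurable; first by exists 0%N.
  by move=> i _; apply: measurableC; exact: measurable_isolated_among.
have EF i : (\int[P]_w (F i w)%:E = pi1%:E)%E by rewrite mean_unjoined_all ?szr.
have EV : (\int[P]_w (V w)%:E = a%:E)%E.
  rewrite integral_sumR//; under eq_bigr do rewrite EF.
  by rewrite sumEFin sumr_const card_ord -[_ *+ n]mulr_natl.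
have kap0 : 0 <= kap by rewrite addr_ge0 ?mulr_ge0 ?exprn_ge0// ltW.
have pi0 : 0 < pi1 by exact: exprn_gt0.
(* For [i != j] the two points themselves are dropped from the lists of possible
   neighbours, so that both lists become the same [J]. *)
have EFF i j : (\int[P]_w (F i w * F j w)%:E <= ((i == j)%:R * pi1 + kap)%:E)%E.
  have [<-|ij] := eqVneq i j.
    rewrite mul1r; under eq_integral.
      move=> w _; rewrite (_ : F i w * F i w = F i w); first over.
      by rewrite /F unjoined_allE indicE; case: (_ \in _); rewrite ?mulr1 ?mulr0.
    by rewrite EF lee_fin lerDl.
  rewrite mul0r add0r.
  pose J := rem (j : nat) (rest i m).
  have uJ : uniq J by rewrite rem_uniq// uniq_rest.
  have memJ l : l \in J = [&& l != j, l != i & (l < m)%N].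
    by rewrite (mem_rem_uniq _ (uniq_rest _ _)) inE/= -mem_rest.
  have szJ : size J = m.-2.
    by rewrite size_rem ?szr// mem_rest im eq_sym ij.
  have iJ : (i : nat) \notin J by rewrite memJ eqxx andbF.
  have jJ : (j : nat) \notin J by rewrite memJ eqxx.
  have ij' : (i : nat) != j by [].
  have := mean_unjoined_pair_le ij' uJ iJ jJ p02; rewrite szJ; apply: le_trans.
  apply: ge0_le_integral => //.
  - by move=> w _; rewrite lee_fin mulr_ge0.
  - by apply/measurable_EFinP; exact: measurable_funM.
  - by apply/measurable_EFinP; apply: measurable_funM; exact: measurable_unjoined_allT.
  - move=> w _; rewrite lee_fin ler_pM//; apply: unjoined_all_le => l.
      by rewrite memJ mem_rest => /and3P[_ -> ->].
    by rewrite memJ mem_rest => /and3P[-> _ ->].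
have EVV : (\int[P]_w (V w ^+ 2)%:E <= (a + n%:R ^+ 2 * kap)%:E)%E.
  have -> : (\int[P]_w (V w ^+ 2)%:E =
      \sum_(i < n) \sum_(j < n) \int[P]_w (F i w * F j w)%:E)%E.
    transitivity (\int[P]_w (\sum_(i < n) \sum_(j < n) F i w * F j w)%:E)%E.
      apply: eq_integral => w _; congr EFin; rewrite expr2 /V mulr_suml.
      by apply: eq_bigr => i _; rewrite mulr_sumr.
    rewrite integral_sumR//.
    - apply: eq_bigr => i _; rewrite integral_sumR//.
      + by move=> j; exact: measurable_funM.
      + by move=> j w; rewrite mulr_ge0.
    - by move=> i; apply: measurable_sum => j; exact: measurable_funM.
    - by move=> i w; apply: sumr_ge0 => j _; rewrite mulr_ge0.
  apply: (@le_trans _ _ (\sum_(i < n) \sum_(j < n) ((i == j)%:R * pi1 + kap)%:E)%E).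
    by apply: lee_sum => i _; apply: lee_sum => j _; exact: EFF.
  under eq_bigr do rewrite sumEFin.
  have inner (i : 'I_n) : \sum_(j < n) ((i == j)%:R * pi1 + kap) = pi1 + n%:R * kap.
    rewrite big_split/= sumr_const card_ord -[kap *+ n]mulr_natl; congr (_ + _).
    rewrite (bigD1 i)//= eqxx mul1r big1 ?addr0// => j ij.
    by rewrite eq_sym (negPf ij) mul0r.
  rewrite sumEFin; under eq_bigr do rewrite inner.
  rewrite sumr_const card_ord -[_ *+ n]mulr_natl.
  have -> : n%:R * (pi1 + n%:R * kap) = a + n%:R ^+ 2 * kap by rewrite /a; ring.
  exact: lexx.
have pt w : a ^+ 2 * \1_A w + 2 * a * V w <= V w ^+ 2 + a ^+ 2.
  have sq : 0 <= (V w - a) ^+ 2 by exact: sqr_ge0.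
  rewrite indicE; case: (boolP (w \in A)) => [|_]; last by rewrite mulr0; lra.
  rewrite inE => wA; rewrite mulr1.
  suff -> : V w = 0 by lra.
  apply: big1 => i _; rewrite /F unjoined_allE indicE -isolatedE memNset//.
  exact: wA.
have mV : measurable_fun setT V by exact: measurable_sum.
have V0 w : 0 <= V w by exact: sumr_ge0.
have a0 : 0 < a by rewrite mulr_gt0// ltr0n.
have a20 : 0 < a ^+ 2 by rewrite exprn_gt0.
have a2_ge0 := ltW a20.
have aa_ge0 : 0 <= 2 * a by rewrite mulr_ge0// ltW.
have main : ((a ^+ 2)%:E * P A + (2 * a ^+ 2)%:E <= (a + n%:R ^+ 2 * kap + a ^+ 2)%:E)%E.
  apply: (@le_trans _ _ (\int[P]_w ((a ^+ 2)%:E * (\1_A w)%:E + (2 * a)%:E * (V w)%:E))%E).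
    rewrite ge0_integralD//.
    - rewrite !ge0_integralZl_EFin//.
      + by rewrite integral_indic// setIT EV -EFinM expr2 mulrA.
      all: try by move=> w _; rewrite lee_fin.
      all: try exact/measurable_EFinP.
    - by move=> w _; rewrite -EFinM lee_fin mulr_ge0.
    - by apply: emeasurable_funM => //; exact/measurable_EFinP.
    - by move=> w _; rewrite -EFinM lee_fin mulr_ge0.
    - by apply: emeasurable_funM => //; exact/measurable_EFinP.
  rewrite EFinD; apply: le_trans (leeD EVV (lexx _)).
  have mVV : measurable_fun setT (fun w => (V w ^+ 2)%:E).
    by apply/measurable_EFinP; exact: measurable_funX.
  have VV0 w : [set: Omega] w -> (0 <= (V w ^+ 2)%:E)%E by rewrite lee_fin exprn_ge0.
  rewrite -[X in (_ <= _ + X)%E](integral_prob_cst P (a ^+ 2)) -ge0_integralD//.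
  apply: ge0_le_integral => //.
  - by move=> w _; rewrite -!EFinM -EFinD lee_fin addr_ge0// mulr_ge0.
  - by apply: emeasurable_funD; apply: emeasurable_funM => //; exact/measurable_EFinP.
  - exact: emeasurable_funD.
  - by move=> w _; rewrite -!EFinM -!EFinD lee_fin.
rewrite -(fineK (fin_num_measure P A mA)) in main *.
move: main; rewrite -EFinM -EFinD !lee_fin; move: (fine (P A)) => x main.
have n0' : 0 < n%:R :> R by rewrite ltr0n.
by apply: second_moment_bound p02 main; rewrite n0.
Qed.

End random_connection_model.

(** * The Borel-Cantelli lemma and Poisson deviations *)

Section borel_cantelli_geometric.
Context {disp : measure_display} {Omega : measurableType disp} {R : realType}.
Variable P : probability Omega R.

Lemma ae_eventually_not (A : nat -> set Omega) (C x : R) (n0 : nat) :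
  (forall n, measurable (A n)) -> 0 <= C -> 0 <= x < 1 ->
  (forall n, (n0 <= n)%N -> (P (A n) <= (C * x ^+ n)%:E)%E) ->
  {ae P, forall w, \forall n \near \oo, ~ A n w}.
Proof.
move=> mA C0 /andP[x0 x1] PA.
pose B n := if (n0 <= n)%N then A n else set0.
have mB n : measurable (B n) by rewrite /B; case: ifP.
have sB : (\sum_(n <oo) P (B n) < +oo)%E.
  apply: (@le_lt_trans _ _ (\sum_(n <oo) (C * x ^+ n)%:E)%E).
    apply: lee_nneseries => // n _; rewrite /B; case: ifPn => [/PA//|_].
    by rewrite measure0 lee_fin mulr_ge0// exprn_ge0.
  have nx : `|x| < 1 by rewrite ger0_norm.
  have cv := @is_cvg_geometric_series R C x nx.
  rewrite (_ : (\sum_(n <oo) _)%E = (limn (series (geometric C x)))%:E) ?ltry//.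
  rewrite -EFin_lim//; congr (limn _); apply/funext => n.
  by rewrite /= /series/= sumEFin.
exists (lim_sup_set B); split.
- by apply: bigcap_measurable => // k _; exact: bigcup_measurable.
- exact: lim_sup_set_cvg0.
move=> w /= nw n _; apply: contrapT => nB; apply: nw.
exists (maxn n n0) => // k /=; rewrite geq_max => /andP[nk n0k] Ak.
by apply: nB; exists k => //; rewrite /B n0k.
Qed.

End borel_cantelli_geometric.

Section poisson_tails.
Context {R : realType}.

Lemma nat_measure_le (m1 m2 : {measure set nat -> \bar R}) (A : set nat) :
  (forall k, A k -> m1 [set k] <= m2 [set k])%E -> (m1 A <= m2 A)%E.
Proof.
move=> m12; have AE : A = \bigcup_(k in A) [set k].
  by apply/seteqP; split => [k Ak|_ [k Ak ->]//]; exists k.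
have tA : trivIset A (fun k : nat => [set k]).
  by apply/trivIsetP => i j _ _ ij; apply/seteqP; split => // k [-> /= /eqP]; rewrite (negPf ij).
rewrite AE !measure_bigcup//.
by apply: lee_nneseries => // k kA; apply: m12; rewrite inE in kA.
Qed.

(** Chernoff bound: tilting a Poisson law of rate [n] by [x ^ k] gives, up to
    normalisation, the Poisson law of rate [x * n], of total mass 1. *)
Lemma poisson_chernoff (m : {measure set nat -> \bar R}) (n : nat) (x : R)
    (A : set nat) :
  (0 < n)%N -> 0 < x ->
  (forall k, m [set k] = (poisson_pmf (n%:R : R) k)%:E) ->
  (forall k, A k -> x * n%:R * ln x <= k%:R * ln x) ->
  (m A <= (expR (- (x * ln x - x + 1)) ^+ n)%:E)%E.
Proof.
move=> n0 x0 mE Ax; have n0' : 0 < n%:R :> R by rewrite ltr0n.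
set c := expR _ ^+ n.
have c0 : 0 <= c by rewrite exprn_ge0// expR_ge0.
have cE : c = expR (n%:R * x - n%:R - x * n%:R * ln x).
  by rewrite /c -expRM_natl; congr expR; ring.
pose s : {nonneg R} := NngNum c0.
have xn0 : 0 < x * n%:R by rewrite mulr_gt0.
apply: (@le_trans _ _ (mscale s (poisson_prob (x * n%:R) 0) A)).
  apply: nat_measure_le => k Ak; rewrite mE.
  have pE : poisson_prob (x * n%:R) 0 [set k] = (poisson_pmf (x * n%:R) k)%:E.
    by rewrite /poisson_prob xn0 esum_set1// lee_fin poisson_pmf_ge0.
  rewrite -[leRHS]/((s%:num)%:E * poisson_prob (x * n%:R) 0 [set k])%E pE.
  rewrite -EFinM lee_fin /poisson_pmf xn0 n0' exprMn.
  have -> : x ^+ k = expR (k%:R * ln x) by rewrite expRM_natl lnK.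
  have -> : s%:num * (expR (k%:R * ln x) * n%:R ^+ k * k`!%:R^-1 * expR (- (x * n%:R))) =
      n%:R ^+ k * k`!%:R^-1 * (c * expR (k%:R * ln x) * expR (- (x * n%:R))).
    by rewrite /=; ring.
  rewrite ler_wpM2l ?mulr_ge0 ?exprn_ge0 ?invr_ge0// cE -!expRD ler_expR.
  by have := Ax k Ak; lra.
rewrite /mscale/= -[leRHS]mule1; apply: lee_wpmul2l; first by rewrite lee_fin.
exact: (@probability_le1 _ _ _ (poisson_prob (x * n%:R) 0)).
Qed.

(** This is [1 + t < expR t] at [t = - ln x]. *)
Lemma entropy_gt0 (x : R) : 0 < x -> x != 1 -> 0 < x * ln x - x + 1.
Proof.
move=> x0 x1.
have l0 : - ln x != 0 by rewrite oppr_eq0 ln_eq0.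
have := expR_gt1Dx l0; rewrite expRN lnK// => h.
have : x * (1 - ln x) < x * x^-1 by rewrite ltr_pM2l.
by rewrite divff ?gt_eqF//; lra.
Qed.

Context {disp : measure_display} {Omega : measurableType disp}.
Variables (P : probability Omega R) (N : nat -> {RV P >-> nat}).
Hypothesis N_poisson : forall n k : nat, (0 < n)%N ->
  distribution P (N n) [set k] = (poisson_pmf (n%:R : R) k)%:E.

(** For [x > 1] the hypothesis describes the values above [x * n], for [x < 1] the
    values below [x * n]. *)
Let poisson_deviation (x : R) (A : nat -> set nat) : 0 < x -> x != 1 ->
  (forall n k, A n k -> x * n%:R * ln x <= k%:R * ln x) ->
  {ae P, forall w, \forall n \near \oo, ~ A n (N n w)}.
Proof.
move=> x0 x1 Ax.
apply: (@ae_eventually_not _ _ _ P (fun n => N n @^-1` A n) 1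
  (expR (- (x * ln x - x + 1))) 1).
- by move=> n; exact: (measurable_funPTI (N n)).
- by [].
- by rewrite expR_ge0 expR_lt1 oppr_lt0 entropy_gt0.
move=> n n0; rewrite mul1r.
exact: (poisson_chernoff (m := distribution P (N n)) n0 x0 (fun k => N_poisson k n0) (Ax n)).
Qed.

Lemma poisson_concentration (lam : R) : 1 < lam ->
  {ae P, forall w, \forall n \near \oo,
    n%:R / lam < (N n w)%:R < lam * n%:R}.
Proof.
move=> l1; have l0 : 0 < lam by lra.
have up : {ae P, forall w, \forall n \near \oo, ~ (lam * n%:R <= (N n w)%:R)}.
  apply: (@poisson_deviation lam (fun n => [set k | lam * n%:R <= k%:R :> R])) => //.
    by rewrite gt_eqF.
  by move=> n k /= h; rewrite ler_pM2r// ln_gt0.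
have dn : {ae P, forall w, \forall n \near \oo, ~ ((N n w)%:R <= lam^-1 * n%:R)}.
  apply: (@poisson_deviation lam^-1 (fun n => [set k | k%:R <= lam^-1 * n%:R :> R])).
  - by rewrite invr_gt0.
  - by rewrite lt_eqF// invf_lt1.
  - by move=> n k /= h; rewrite ler_nM2r// ln_lt0// invr_gt0 l0 invf_lt1.
apply: filterS2 up dn => w up dn; near=> n.
apply/andP; split; rewrite ltNge; apply/negP.
- rewrite mulrC; near: n; exact: dn.
- near: n; exact: up.
Unshelve. all: by end_near. Qed.

End poisson_tails.

(** * Estimates along a geometric sequence *)

Section real_estimates.
Context {R : realType}.

Lemma expR_bound_linear (e t : R) : 0 < e -> 0 <= t -> t <= e^-1 * expR (e * t).
Proof.
move=> e0 t0; rewrite mulrC ler_pdivlMr// mulrC.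
by apply: le_trans (expR_ge1Dx _); rewrite lerDr.
Qed.

Variables (lam eps : R).
Hypothesis lam1 : 1 < lam.
Hypothesis eps01 : 0 < eps < 1.
Hypothesis lam_up : (1 + eps / 2) * lam ^+ 3 <= 1 + eps.
Hypothesis lam_dn : (1 - eps) * lam ^+ 3 <= 1 - eps / 2.
Let l := ln lam.
Let l0 : 0 < l. Proof. exact: ln_gt0. Qed.
Let lam0 : 0 < lam. Proof. exact: lt_trans lam1. Qed.
Let lamE k : lam ^+ k = expR (k%:R * l).
Proof. by rewrite expRM_natl lnK. Qed.

(** The two error probabilities are at most [expR (- (eps / 2 * (k * ln lam)))] up to
    factors linear in [k]; half of the exponent absorbs these factors. *)
Definition decay : R := expR (- (eps / 4 * l)).

Lemma decay_itv : 0 <= decay < 1.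
Proof.
have /andP[e0 _] := eps01.
by rewrite /decay expR_ge0 expR_lt1 oppr_lt0 mulr_gt0// divr_gt0.
Qed.

Let decayE k : decay ^+ k = expR (- (eps / 4 * (k%:R * l))).
Proof. by rewrite /decay -expRM_natl; congr expR; ring. Qed.

Let log_const : R := l + (eps / 4)^-1.

Let log_const0 : 0 <= log_const.
Proof.
have /andP[e0 _] := eps01.
by rewrite addr_ge0 ?invr_ge0 ?divr_ge0 ?ltW.
Qed.

Let log_le k : k.+1%:R * l <= log_const * expR (eps / 4 * (k%:R * l)).
Proof.
have /andP[e0 _] := eps01.
have e4 : 0 < eps / 4 by rewrite divr_gt0.
have t0 : 0 <= k%:R * l by rewrite mulr_ge0// ltW.
have -> : k.+1%:R * l = k%:R * l + l by rewrite -natr1; ring.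
have := expR_bound_linear e4 t0.
have : 1 <= expR (eps / 4 * (k%:R * l)) by rewrite -[leLHS]expR0 ler_expR mulr_ge0// ltW.
rewrite /log_const; move: (expR _) => E E1.
move: (k%:R * l) => t; have : l <= l * E by rewrite ler_peMr// ltW.
lra.
Qed.

Lemma log_over_power_le k : k.+1%:R * l / lam ^+ k <= log_const * decay ^+ k.
Proof.
have /andP[e0 e1] := eps01.
rewrite lamE decayE -expRN; apply: le_trans (ler_wpM2r (expR_ge0 _) (log_le k)) _.
rewrite -[leLHS]mulrA -expRD ler_wpM2l// ler_expR.
have t0 : 0 <= k%:R * l by rewrite mulr_ge0// ltW.
by move: (k%:R * l) t0 => t t0; nra.
Qed.

Lemma decay_eventually (eta : R) : 0 < eta ->
  exists k0, forall k, (k0 <= k)%N -> k.+1%:R * l / lam ^+ k <= eta.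
Proof.
move=> eta0; have /andP[x0 x1] := decay_itv.
have : (fun k => log_const * decay ^+ k) @ \oo --> (0 : R).
  rewrite -[X in _ --> X](mulr0 log_const); apply: cvgMr.
  by apply: cvg_expr; rewrite ger0_norm.
move/cvgrPdist_le/(_ _ eta0) => [k0 _ H]; exists k0 => k kk.
apply: le_trans (log_over_power_le k) _; have := H k kk.
by rewrite /= sub0r normrN; apply: le_trans; exact: ler_norm.
Qed.

(** With [p] as in the hypothesis, the left-hand side is at most about [lam ^+ k]
    to the power [- eps / 2]; the factor [lam ^+ 3] of [lam_up] pays for
    the width of a block and for the deviations of the number of points and of
    the connection mass. *)
Lemma union_estimate k (p : R) : 0 <= p <= 1 ->
  (1 + eps) * k%:R * l / (lam ^+ k * lam ^+ 2) <= p ->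
  (Num.truncn (lam ^+ 2 * lam ^+ k))%:R * (1 - p) ^+ Num.truncn (lam ^+ k / lam) <=
  lam ^+ 2 * expR 1 * decay ^+ k.
Proof.
move=> /andP[p0 p1] hp; have /andP[e0 e1] := eps01.
have Lk0 : 0 < lam ^+ k by rewrite exprn_gt0.
have M0 : 0 <= lam ^+ 2 * lam ^+ k by rewrite mulr_ge0 ?exprn_ge0// ltW.
have Mle : (Num.truncn (lam ^+ 2 * lam ^+ k))%:R <= lam ^+ 2 * lam ^+ k.
  by rewrite truncn_le.
set L := Num.truncn (lam ^+ k / lam).
have Lge : lam ^+ k / lam - 1 <= L%:R.
  by have := truncnS_gt (lam ^+ k / lam); rewrite -/L -natr1; lra.
have powle : (1 - p) ^+ L <= expR (- (p * L%:R)).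
  rewrite -mulNr expRM_natr lerXn2r ?nnegrE ?subr_ge0 ?expR_ge0//.
  exact: expR_ge1Dx.
apply: (le_trans (ler_pM _ _ Mle powle)); rewrite ?ler0n ?exprn_ge0 ?subr_ge0//.
rewrite -[leLHS]mulrA -[leRHS]mulrA ler_wpM2l ?exprn_ge0 ?(ltW lam0)//.
rewrite lamE decayE -!expRD ler_expR.
have t0 : 0 <= k%:R * l by rewrite mulr_ge0// ltW.
suff : (1 + eps / 2) * (k%:R * l) - 1 <= p * L%:R.
  by move: (k%:R * l) t0 (p * _) => t t0 s; nra.
apply: (@le_trans _ _ (p * (lam ^+ k / lam - 1))); last by rewrite ler_wpM2l.
suff : (1 + eps / 2) * (k%:R * l) <= p * (lam ^+ k / lam).
  by rewrite mulrBr mulr1; lra.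
apply: (@le_trans _ _ ((1 + eps) * k%:R * l / (lam ^+ k * lam ^+ 2) * (lam ^+ k / lam))); last first.
  by rewrite ler_wpM2r// divr_ge0// ltW.
have -> : (1 + eps) * k%:R * l / (lam ^+ k * lam ^+ 2) * (lam ^+ k / lam) =
    (1 + eps) * (k%:R * l) / lam ^+ 3.
  by field; rewrite !gt_eqF.
rewrite ler_pdivlMr ?exprn_gt0//.
by move: (lam ^+ 3) lam_up (k%:R * l) t0 => c hc t t0; nra.
Qed.

Definition second_moment_const : R := lam ^+ 2 + (lam + 6) * log_const.

Lemma second_moment_const_ge0 : 0 <= second_moment_const.
Proof.
have lam_ge0 := ltW lam0.
by apply: addr_ge0; [exact: exprn_ge0|apply: mulr_ge0 => //; lra].
Qed.

(** Here the power of [1 - p] is at least about [lam ^+ k] to the power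
    [- (1 - eps / 2)], while [p] and the inverse of the number of points are at
    most about [lam ^- k], up to a factor linear in [k]. *)
Lemma second_moment_estimate k (p : R) : 0 < p <= 1 / 2 -> (1 - p)^-1 <= lam ->
  p <= (1 - eps) * k.+1%:R * l / lam ^+ k ->
  ((Num.truncn (lam ^+ k / lam)).+1%:R^-1 + p) /
     (1 - p) ^+ Num.truncn (lam ^+ 2 * lam ^+ k) + ((1 - p) ^- 2 - 1) <=
  second_moment_const * decay ^+ k.
Proof.
move=> /andP[p0 p2] pl hp; have /andP[e0 e1] := eps01.
have b0 : 0 < 1 - p by lra.
have Lk0 : 0 < lam ^+ k by rewrite exprn_gt0.
have M0 : 0 <= lam ^+ 2 * lam ^+ k by rewrite mulr_ge0 ?exprn_ge0// ltW.
set M := Num.truncn (lam ^+ 2 * _).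
have Mle : M%:R <= lam ^+ 2 * lam ^+ k by rewrite truncn_le.
have Linv : (Num.truncn (lam ^+ k / lam)).+1%:R^-1 <= lam / lam ^+ k.
  rewrite -[leRHS]invrK lef_pV2 ?posrE ?invr_gt0 ?divr_gt0// invf_div.
  by rewrite ltW// truncnS_gt.
set t := k%:R * l; set s := k.+1%:R * l.
have s0 : 0 <= s by rewrite mulr_ge0// ltW.
have t0 : 0 <= t by rewrite mulr_ge0// ltW.
have st : s = t + l by rewrite /s /t -natr1 mulrDl mul1r.
have ple : p <= s / lam ^+ k.
  apply: (le_trans hp); rewrite ler_pM2r ?invr_gt0// -mulrA -/s; nra.
(* [(1 - p)^-1 = 1 + p / (1 - p) <= 1 + p * lam <= expR (p * lam)]. *)
have powle : ((1 - p) ^+ M)^-1 <= expR ((1 - eps / 2) * s).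
  rewrite -exprVn; apply: (@le_trans _ _ (expR (p * lam) ^+ M)).
    rewrite lerXn2r ?nnegrE ?invr_ge0 ?expR_ge0 ?(ltW b0)//.
    apply: le_trans (expR_ge1Dx _).
    have -> : (1 - p)^-1 = 1 + p * (1 - p)^-1 by field; lra.
    by rewrite lerD2l ler_wpM2l// ltW.
  rewrite -expRM_natr ler_expR.
  apply: (@le_trans _ _ (p * lam * (lam ^+ 2 * lam ^+ k))).
    by rewrite ler_wpM2l// mulr_ge0// ltW.
  apply: (@le_trans _ _ ((1 - eps) * k.+1%:R * l / lam ^+ k * lam * (lam ^+ 2 * lam ^+ k))).
    by rewrite !ler_wpM2r// ltW.
  have -> : (1 - eps) * k.+1%:R * l / lam ^+ k * lam * (lam ^+ 2 * lam ^+ k) =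
      (1 - eps) * lam ^+ 3 * s.
    by rewrite /s; field; rewrite gt_eqF.
  by rewrite ler_wpM2r.
(* Equality holds at [p = 1 / 2], and both sides vanish at [0]. *)
have tail : (1 - p) ^- 2 - 1 <= 6 * p.
  rewrite lerBlDr -[(1 - p) ^- 2]mul1r ler_pdivrMr ?exprn_gt0//.
  have : 0 <= p * (1 - 2 * p) * (4 - 3 * p) by rewrite !mulr_ge0//; lra.
  by rewrite expr2; lra.
have E1 : expR ((1 - eps / 2) * s) <= lam * lam ^+ k * expR (- (eps / 2 * t)).
  have lE : lam = expR l by rewrite lnK.
  have el : 0 <= eps * l by rewrite mulr_ge0 ?(ltW l0)// ltW.
  rewrite lamE -/t [X in X * _ * _]lE -!expRD ler_expR st; lra.
set E := expR (- (eps / 2 * t)) in E1.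
have Edecay : E = decay ^+ k * decay ^+ k.
  by rewrite decayE -expRD /E; congr expR; rewrite -/t; field.
have d0 : 0 <= decay ^+ k by rewrite exprn_ge0//; case/andP: decay_itv.
have d1 : decay ^+ k <= 1 by rewrite exprn_ile1//; case/andP: decay_itv => // _ /ltW.
have sE : s * decay ^+ k <= log_const.
  rewrite decayE expRN -ler_pdivlMr ?invr_gt0 ?expR_gt0// invrK.
  exact: log_le.
have psk : s / lam ^+ k <= log_const * decay ^+ k by exact: log_over_power_le.
apply: (@le_trans _ _ ((lam / lam ^+ k + s / lam ^+ k) *
    (lam * lam ^+ k * E) + 6 * (s / lam ^+ k))).
  apply: lerD; last by apply: (le_trans tail); rewrite ler_wpM2l.
  apply: ler_pM; rewrite ?addr_ge0 ?invr_ge0 ?exprn_ge0 ?(ltW p0) ?(ltW b0)//.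
    exact: lerD.
  exact: le_trans E1.
have -> : (lam / lam ^+ k + s / lam ^+ k) * (lam * lam ^+ k * E) =
   lam ^+ 2 * E + lam * (s * decay ^+ k) * decay ^+ k.
  by rewrite Edecay; field; rewrite gt_eqF.
have h1 : lam ^+ 2 * E <= lam ^+ 2 * decay ^+ k.
  by rewrite ler_wpM2l ?exprn_ge0 ?(ltW lam0)// Edecay ler_piMl.
have h2 : lam * (s * decay ^+ k) * decay ^+ k <= lam * log_const * decay ^+ k.
  by rewrite ler_wpM2r// ler_wpM2l// ltW.
rewrite /second_moment_const; move: h1 h2 psk.
by move: (decay ^+ k) (s / _) => u v; lra.
Qed.

End real_estimates.

(** * Isolated vertices and the radius *)

Section graph_facts.
Context {R : realType} (d : nat).
Variables (g : R -> R) (x : nat -> Rn R d) (u : nat -> nat -> R).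
Hypothesis g_noninc : forall s t : R, 0 <= s -> s <= t -> g t <= g s.

Definition isolated_vertex (r : R) (i m : nat) : Prop :=
  forall j, (j < m)%N -> j != i ->
    g (torus_dist (x i) (x j) / r) < u (minn i j) (maxn i j).

Lemma torus_dist_ge0 (y z : Rn R d) : 0 <= torus_dist y z.
Proof. by rewrite torus_dist_sub; exact: sqrtr_ge0. Qed.

Lemma no_isolated_radius_le (N : nat) (r : R) : 0 < r ->
  (forall i, (i < N)%N -> ~ isolated_vertex r i N) ->
  (no_isolated_radius g N x u <= r%:E)%E.
Proof.
move=> r0 H; apply: ereal_inf_lbound; exists r => //; split => //.
apply: eq_card0 => i; apply/negbTE/negP; rewrite !inE => /forallP iso; apply: (H i (ltn_ord i)) => j jN ji.
have := iso (Ordinal jN); rewrite /adj negb_and negbK => /orP[/eqP ij|].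
  by rewrite ij eqxx in ji.
by rewrite -ltNge.
Qed.

(** Adjacency is monotone in the radius, so an isolated vertex at radius [r]
    is isolated at every smaller radius. *)
Lemma no_isolated_radius_ge (N : nat) (r : R) i : (i < N)%N ->
  isolated_vertex r i N -> (r%:E <= no_isolated_radius g N x u)%E.
Proof.
move=> iN iso; apply: le_ereal_inf_tmp => _ [s [s0 /eqP Hs] <-].
rewrite lee_fin leNgt; apply/negP => sr; move: Hs; apply/negP.
rewrite /isolated_count -lt0n; apply/card_gt0P; exists (Ordinal iN); rewrite !inE.
apply/forallP => j; rewrite /adj negb_and negbK -ltNge.
case: eqVneq => //= ij.
have ji : (j : nat) != i by apply: contra_neq ij => ji; exact: val_inj.
apply: le_lt_trans (iso j (ltn_ord j) ji).
have r0 : 0 < r := lt_trans s0 sr.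
apply: g_noninc; first by rewrite divr_ge0 ?torus_dist_ge0// ltW.
by rewrite ler_wpM2l ?torus_dist_ge0// lef_pV2 ?posrE// ltW.
Qed.

Lemma no_isolated_radius_ge0 N : (0 <= no_isolated_radius g N x u)%E.
Proof. by apply: le_ereal_inf_tmp => _ [s [s0 _] <-]; rewrite lee_fin ltW. Qed.

End graph_facts.

Section extended_real_powers.
Context {R : realType}.

Lemma lee_pow_radius (x : \bar R) (c r : R) n : 0 <= c -> (0 <= x)%E ->
  (x <= r%:E)%E -> (c%:E * x ^+ n <= (c * r ^+ n)%:E)%E.
Proof.
move=> c0; case: x => [x| |]//; rewrite !lee_fin -EFin_expe -EFinM lee_fin => x0 xr.
by rewrite ler_wpM2l// lerXn2r ?nnegrE// (le_trans x0).
Qed.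

Lemma gee_pow_radius (x : \bar R) (c r : R) n : 0 < c -> (0 < n)%N -> 0 <= r ->
  (r%:E <= x)%E -> ((c * r ^+ n)%:E <= c%:E * x ^+ n)%E.
Proof.
move=> c0 n0 r0; case: x => [x| |]//.
  rewrite !lee_fin -EFin_expe -EFinM lee_fin => rx.
  by rewrite (ler_wpM2l (ltW c0))// lerXn2r ?nnegrE// (le_trans r0).
move=> _; suff -> : (+oo ^+ n = +oo :> \bar R)%E by rewrite gt0_muley ?lte_fin// leey.
by case: n n0 => // n _; elim: n => [|n IH]; rewrite ?expe1// expeS IH mulyy.
Qed.

Lemma cvg_to_1e (f : nat -> \bar R) :
  (forall e : R, 0 < e < 1 ->
    \forall n \near \oo, ((1 - e)%:E <= f n <= (1 + e)%:E)%E) ->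
  f @ \oo --> 1%E.
Proof.
move=> H; apply/fine_cvgP; split.
  have h2 : 0 < (2^-1 : R) < 1 by lra.
  have := H _ h2; apply: filterS => n /andP[]; case: (f n) => [x| |]//.
apply/cvgrPdist_le => e e0.
have em : 0 < Num.min e 2^-1 < 1 by rewrite lt_min e0 gt_min; lra.
have := H _ em; apply: filterS => n /=; case: (f n) => [x| |] /andP[]//=.
rewrite !lee_fin => h1 h2.
have me : Num.min e 2^-1 <= e by rewrite ge_min lexx.
by rewrite ler_norml; apply/andP; split; lra.
Qed.

End extended_real_powers.

(** * The almost sure limit *)

Lemma uniform_prob_tail {R : realType} (a : R) : 0 <= a <= 1 ->
  uniform_prob (@ltr01 R) `]a, +oo[%classic = (1 - a)%:E.
Proof.
move=> /andP[a0 a1]; rewrite /uniform_prob.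
transitivity (\int[lebesgue_measure]_(x in `]a, +oo[%classic) (\1_(`[0, 1]%classic : set R) x)%:E)%E.
  apply: eq_integral => x _; rewrite /uniform_pdf indicE subr0 invr1.
  by rewrite mem_setE in_itv/=; case: ifP.
rewrite integral_indic//.
rewrite (_ : _ `&` _ = `]a, 1]%classic); last first.
  by apply/seteqP; split => x /=; rewrite !in_itv/=; lra.
rewrite -[LHS]/(lebesgue_measure `]a, 1]%classic) lebesgue_measure_itv/= lte_fin.
case: ifPn => [_|]; first by rewrite EFinB.
by rewrite -leNgt => a1'; rewrite (_ : a = 1) ?subrr//; apply/eqP; rewrite eq_le a1.
Qed.

Section radius_roots.
Context {R : realType} (d : nat).
Hypothesis d0 : (0 < d)%N.

Definition dth_root (y : R) : R := y `^ (d%:R^-1).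

Lemma dth_rootK y : 0 <= y -> dth_root y ^+ d = y.
Proof.
move=> y0; rewrite /dth_root -powR_mulrn ?powR_ge0// -powRrM mulVf ?powRr1//.
by rewrite pnatr_eq0 -lt0n.
Qed.

Lemma dth_root_ge0 y : 0 <= dth_root y. Proof. exact: powR_ge0. Qed.

Lemma dth_root_gt0 y : 0 < y -> 0 < dth_root y. Proof. exact: powR_gt0. Qed.

End radius_roots.

Section strong_law.
Context {R : realType} (d : nat).
Hypothesis d0 : (0 < d)%N.
Variables (g : R -> R) (alpha : R).
Hypothesis g01 : forall t : R, 0 <= t -> 0 <= g t <= 1.
Hypothesis g_noninc : forall s t : R, 0 <= s -> s <= t -> g t <= g s.
Hypothesis alpha_gt0 : 0 < alpha.
Hypothesis alphaE : (\int[leb R d]_x (g (enorm x))%:E = alpha%:E)%E.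
Context {disp : measure_display} {Omega : measurableType disp}.
Variables (P : probability Omega R) (X : nat -> {RV P >-> Rn R d}).
Variables (N : nat -> {RV P >-> nat}) (U : nat -> nat -> {RV P >-> R}).
Hypothesis X_unif : forall (i : nat) (A : set (Rn R d)), measurable A ->
  distribution P (X i) A = leb R d (A `&` torus R d).
Hypothesis X_indep : independent_family P setT (fun (i : nat) (w : Omega) => X i w).
Hypothesis N_poisson : forall n k : nat, (0 < n)%N ->
  distribution P (N n) [set k] = (poisson_pmf (n%:R : R) k)%:E.
Hypothesis U_tail : forall (i j : nat) (a : R), (i < j)%N -> 0 <= a <= 1 ->
  P (U i j @^-1` `]a, +oo[%classic) = (1 - a)%:E.
Hypothesis U_indep : independent_family P [set p : nat * nat | (p.1 < p.2)%N]
  (fun p w => U p.1 p.2 w).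
Hypothesis XU_indep : forall A B,
  sigma_family setT (fun (i : nat) (w : Omega) => X i w) A ->
  sigma_family [set p : nat * nat | (p.1 < p.2)%N] (fun p w => U p.1 p.2 w) B ->
  (P (A `&` B) = P A * P B)%E.

Let conn (r : R) (z : Rn R d * Rn R d) : R := g (torus_dist z.1 z.2 / r).

Let measurable_conn r : 0 <= r -> measurable_fun setT (conn r).
Proof.
move=> r0; apply: (measurable_profile g_noninc (f := fun z => torus_dist z.1 z.2 / r)).
  apply: measurable_funM => //.
  rewrite (_ : (fun z => _) = @enorm R d \o (fun z => torus_sub z.1 z.2)).
    apply: measurableT_comp; [exact: measurable_enorm|exact: measurable_torus_sub].
  by apply/funext => z; rewrite torus_dist_sub.
by move=> z; rewrite divr_ge0// torus_dist_ge0.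
Qed.

Let conn01 r z : 0 <= r -> 0 <= conn r z <= 1.
Proof. by move=> r0; apply: g01; rewrite divr_ge0// torus_dist_ge0. Qed.

Let connC r x y : conn r (x, y) = conn r (y, x).
Proof. by rewrite /conn torus_distC. Qed.

Definition mass (r : R) : R := fine (connection_mass d g r).

Let massE r : 0 < r -> (connection_mass d g r = (mass r)%:E)%E.
Proof.
move=> r0; rewrite /mass fineK// ge0_fin_numE.
  by apply: le_lt_trans (connection_mass_le g01 g_noninc alphaE r0) _; exact: ltry.
apply: integral_ge0 => y _; rewrite lee_fin.
by have /andP[] := g01 (divr_ge0 (enorm_ge0 y) (ltW r0)).
Qed.

Let conn_mass r x : 0 < r ->
  (\int[distribution P (X 0%N)]_y (conn r (x, y))%:E = (mass r)%:E)%E.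
Proof.
move=> r0; rewrite -massE// /connection_mass.
have f0 (y : Rn R d) : (0 <= (g (enorm y / r))%:E)%E.
  by rewrite lee_fin; have /andP[] := g01 (divr_ge0 (enorm_ge0 y) (ltW r0)).
have mf : measurable_fun setT (fun y : Rn R d => (g (enorm y / r))%:E).
  apply/measurable_EFinP.
  apply: (measurable_profile g_noninc (f := fun y => enorm y / r)).
    by apply: measurable_funM => //; exact: measurable_enorm.
  by move=> y; rewrite divr_ge0 ?enorm_ge0// ltW.
rewrite -(integral_torus_law x (X_unif 0%N) mf f0).
by apply: eq_integral => y _; rewrite /conn torus_dist_sub.
Qed.

Let mass_le r : 0 < r -> mass r <= alpha * r ^+ d.
Proof. by move=> r0; rewrite -lee_fin -massE//; exact: connection_mass_le. Qed.

Let X_law i A : measurable A -> distribution P (X i) A = distribution P (X 0%N) A.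
Proof. by move=> mA; rewrite !X_unif. Qed.

Let isolated r i m := isolated_among X U (conn r) i m.

Let mass01 r : 0 < r -> 0 <= mass r <= 1.
Proof.
move=> r0; rewrite -!lee_fin -(conn_mass point)//; apply/andP; split.
  by apply: integral_ge0 => y _; rewrite lee_fin; case/andP: (conn01 (point, y) (ltW r0)).
rewrite -(integral_prob_cst (distribution P (X 0%N)) 1).
apply: ge0_le_integral => //.
- by move=> y _; rewrite lee_fin; case/andP: (conn01 (point, y) (ltW r0)).
- apply/measurable_EFinP.
  exact: (measurableT_comp (measurable_conn (ltW r0)) (measurable_pair1 _)).
- by move=> y _; rewrite lee_fin; case/andP: (conn01 (point, y) (ltW r0)).
Qed.

Let measurable_isolated r i m : 0 <= r -> measurable (isolated r i m).
Proof. by move=> r0; apply: measurable_isolated_among; exact: measurable_conn. Qed.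

Let some_isolated_le r n m : 0 < r ->
  (P [set w | exists2 i, (i < n)%N & isolated r i m w] <=
   (n%:R * (1 - mass r) ^+ m.-1)%:E)%E.
Proof.
move=> r0; apply: (prob_some_isolated_le X_indep U_indep XU_indep X_law U_tail) => //.
- exact: measurable_conn (ltW r0).
- by move=> z; exact: conn01 (ltW r0).
- by move=> x; exact: conn_mass.
Qed.

Let none_isolated_le r n m : 0 < r -> (0 < n <= m)%N -> 0 < mass r <= 1 / 2 ->
  (P [set w | forall i, (i < n)%N -> ~ isolated r i m w] <=
   ((n%:R^-1 + mass r) / (1 - mass r) ^+ m + ((1 - mass r) ^- 2 - 1))%:E)%E.
Proof.
move=> r0; apply: (prob_none_isolated_le X_indep U_indep XU_indep X_law U_tail) => //.
- exact: measurable_conn (ltW r0).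
- by move=> z; exact: conn01 (ltW r0).
- by move=> x; exact: conn_mass.
Qed.

Section fixed_precision.
Variables (lam eps : R).
Hypothesis lam1 : 1 < lam.
Hypothesis eps01 : 0 < eps < 1.
Hypothesis lam_up : (1 + eps / 2) * lam ^+ 3 <= 1 + eps.
Hypothesis lam_dn : (1 - eps) * lam ^+ 3 <= 1 - eps / 2.
Let l := ln lam.
Let l0 : 0 < l. Proof. exact: ln_gt0. Qed.
Let lam0 : 0 < lam. Proof. exact: lt_trans lam1. Qed.
Let pow0 k : 0 < lam ^+ k. Proof. exact: exprn_gt0. Qed.
Let e0 : 0 < eps. Proof. by case/andP: eps01. Qed.
Let e1 : eps < 1. Proof. by case/andP: eps01. Qed.

(** For [lam ^+ k <= n < lam ^+ k.+1] the number of points lies between [few k]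
    and [many k]. *)
Let few k := (Num.truncn (lam ^+ k / lam)).+1.
Let many k := Num.truncn (lam ^+ 2 * lam ^+ k).

(** Targets for [alpha * r ^+ d]. On the block, [n / ln n] lies between
    [lam ^+ k / (k.+1%:R * l)] and [lam ^+ k.+1 / (k%:R * l)]: the upper bound turns
    [volume_above] into a ratio of at most [1 + eps], the lower one turns
    [volume_below] into a ratio of at least [1 - eps]. *)
Let volume_above k : R := (1 + eps) * k%:R * l / (lam ^+ k * lam).
Let volume_below k : R := (1 - eps) * k.+1%:R * l / lam ^+ k.
Let radius_above k := dth_root d (volume_above k / alpha).
Let radius_below k := dth_root d (volume_below k / alpha).

Let volume_above_ge0 k : 0 <= volume_above k.
Proof. by rewrite /volume_above divr_ge0 ?mulr_ge0 ?addr_ge0// ltW. Qed.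

Let volume_below_gt0 k : 0 < volume_below k.
Proof. by rewrite /volume_below divr_gt0 ?mulr_gt0 ?subr_gt0. Qed.

Let radius_aboveE k : alpha * radius_above k ^+ d = volume_above k.
Proof.
rewrite /radius_above dth_rootK//; first by rewrite mulrC divfK ?gt_eqF.
by rewrite divr_ge0// ltW.
Qed.

Let radius_belowE k : alpha * radius_below k ^+ d = volume_below k.
Proof.
rewrite /radius_below dth_rootK//; first by rewrite mulrC divfK ?gt_eqF.
by rewrite divr_ge0 ?ltW.
Qed.

Let volumes_small eta : 0 < eta -> exists k0, forall k, (k0 <= k)%N ->
  [/\ volume_above k <= eta, volume_below k <= eta & k.+1%:R * l / lam ^+ k <= eta].
Proof.
move=> eta0; have eta2 : 0 < eta / 2 by rewrite divr_gt0.
have [k0 H] := decay_eventually lam1 eps01 eta2; exists k0 => k /H {}H.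
have s0 : 0 <= k.+1%:R * l / lam ^+ k by rewrite divr_ge0 ?mulr_ge0// ltW.
rewrite -/l in H; split; last lra.
- have v0 : 0 <= k%:R * l / lam ^+ k by rewrite divr_ge0 ?mulr_ge0// ltW.
  have vs : k%:R * l / lam ^+ k <= k.+1%:R * l / lam ^+ k.
    by rewrite ler_pM2r ?invr_gt0// ler_pM2r// ler_nat.
  have vl : k%:R * l / lam ^+ k / lam <= k%:R * l / lam ^+ k.
    by rewrite ler_pdivrMr// ler_peMr// ltW.
  have -> : volume_above k = (1 + eps) * (k%:R * l / lam ^+ k / lam).
    by rewrite /volume_above; field; rewrite !gt_eqF.
  have w0 : 0 <= k%:R * l / lam ^+ k / lam by rewrite divr_ge0// ltW.
  have : (1 + eps) * (k%:R * l / lam ^+ k / lam) <= 2 * (k%:R * l / lam ^+ k / lam).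
    by rewrite ler_wpM2r//; move: e1; lra.
  by lra.
- have -> : volume_below k = (1 - eps) * (k.+1%:R * l / lam ^+ k).
    by rewrite /volume_below; ring.
  have : (1 - eps) * (k.+1%:R * l / lam ^+ k) <= k.+1%:R * l / lam ^+ k.
    by rewrite ler_piMl// gerBl ltW.
  by lra.
Qed.

(** [connection_mass_ge] with the smallness of the radius expressed on [alpha * r ^+ d]. *)
Let mass_ge beta : beta < alpha -> exists2 eta, 0 < eta &
  forall r, 0 < r -> alpha * r ^+ d <= eta -> beta * r ^+ d <= mass r.
Proof.
move=> ba; have [rho rho0 H] := connection_mass_ge g01 g_noninc alphaE ba.
exists (alpha * rho ^+ d); first by rewrite mulr_gt0// exprn_gt0.
move=> r r0 rle; rewrite -lee_fin -massE//; apply: H; rewrite r0/=.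
by move: rle; rewrite ler_pM2l// ler_pXn2r// nnegrE ltW.
Qed.

Let alpha_lam : alpha / lam < alpha.
Proof. by rewrite ltr_pdivrMr// ltr_pMr. Qed.

(** A vertex isolated at this radius, for some [n] of the block, would be such an [i]. *)
Lemma ae_none_isolated_above : {ae P, forall w, \forall k \near \oo,
  ~ exists2 i, (i < many k)%N & isolated (radius_above k) i (few k) w}.
Proof.
have [eta eta0 Hmass] := mass_ge alpha_lam.
have [k0 Hk0] := volumes_small eta0.
apply: (@ae_eventually_not _ _ _ P
  (fun k => [set w | exists2 i, (i < many k)%N & isolated (radius_above k) i (few k) w])
  (lam ^+ 2 * expR 1) (decay lam eps) (maxn k0 1)).
- move=> k.
  rewrite (_ : [set w | _] = \bigcup_(i in [set i | (i < many k)%N])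
    isolated (radius_above k) i (few k)); last first.
    by apply/seteqP; split => w; [move=> [i ? ?]; exists i|move=> [i ? ?]; exists i].
  by apply: bigcup_measurable => i _; apply: measurable_isolated; exact: dth_root_ge0.
- by rewrite mulr_ge0 ?exprn_ge0 ?expR_ge0// ltW.
- exact: decay_itv.
move=> k; rewrite geq_max => /andP[k0k k1].
have r0 : 0 < radius_above k.
  apply: dth_root_gt0; rewrite divr_gt0// /volume_above divr_gt0 ?mulr_gt0 ?addr_gt0//.
  by rewrite ltr0n.
apply: (le_trans (some_isolated_le _ _ r0)); rewrite lee_fin.
apply: union_estimate => //; first exact: mass01.
have [small _ _] := Hk0 k k0k.
have := Hmass _ r0; rewrite radius_aboveE => /(_ small); apply: le_trans.
rewrite [leRHS]mulrAC radius_aboveE /volume_above le_eqVlt; apply/orP; left; apply/eqP.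
by rewrite -/l; field; rewrite !gt_eqF.
Qed.

(** When some [i] is isolated in this sense, it is an isolated vertex for every [n] of
    the block. *)
Lemma ae_some_isolated_below : {ae P, forall w, \forall k \near \oo,
  ~ forall i, (i < few k)%N -> ~ isolated (radius_below k) i (many k) w}.
Proof.
have [eta eta0 Hmass] := mass_ge alpha_lam.
(* The four bounds give, in this order, a positive mass, a mass of at most one half,
   [(1 - p)^-1 <= lam], and [few k <= many k]. *)
pose eta' := Num.min eta (Num.min (1 / 2) (Num.min (1 - lam^-1) (l * (lam ^+ 3 - 1) / lam))).
have lamV1 : lam^-1 < 1 by rewrite invf_lt1.
have lam3 : 1 < lam ^+ 3 by rewrite exprn_egt1.
have eta'0 : 0 < eta'.
  rewrite /eta' !lt_min eta0 divr_gt0//= subr_gt0 lamV1/=.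
  by rewrite divr_gt0// mulr_gt0// subr_gt0.
have [k0 Hk0] := volumes_small eta'0.
apply: (@ae_eventually_not _ _ _ P
  (fun k => [set w | forall i, (i < few k)%N -> ~ isolated (radius_below k) i (many k) w])
  (second_moment_const lam eps) (decay lam eps) k0).
- move=> k.
  rewrite (_ : [set w | _] = \bigcap_(i in [set i | (i < few k)%N])
    ~` isolated (radius_below k) i (many k))//.
  apply: bigcap_measurable; first by exists 0%N.
  by move=> i _; apply: measurableC; apply: measurable_isolated; exact: dth_root_ge0.
- exact: second_moment_const_ge0.
- exact: decay_itv.
move=> k k0k; have [_] := Hk0 k k0k.
rewrite /eta' !le_min => /and4P[small1 small2 small3 small4] /and4P[_ _ _ small5].
have r0 : 0 < radius_below k by apply: dth_root_gt0; rewrite divr_gt0.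
have mle : mass (radius_below k) <= volume_below k.
  by rewrite -radius_belowE; exact: mass_le.
have m0 : 0 < mass (radius_below k).
  apply: lt_le_trans (Hmass _ r0 _); last by rewrite radius_belowE.
  by rewrite mulr_gt0 ?divr_gt0// exprn_gt0.
have fm : (0 < few k <= many k)%N.
  rewrite /few /many ltn0Sn/= truncn_gt_nat -natr1.
  have := truncn_le (lam ^+ k / lam); rewrite divr_ge0 ?(ltW lam0) ?(ltW (pow0 k))//.
  suff : lam ^+ k / lam + 1 <= lam ^+ 2 * lam ^+ k by lra.
  have l_le : l <= k.+1%:R * l / lam ^+ k * lam ^+ k.
    by rewrite divfK ?gt_eqF// ler_peMl ?(ltW l0)// ler1n.
  have h := le_trans l_le (ler_wpM2r (ltW (pow0 k)) small5).
  have e : l * (lam ^+ 3 - 1) / lam * lam ^+ k = l * ((lam ^+ 3 - 1) * (lam^-1 * lam ^+ k)).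
    by ring.
  rewrite e ler_pMr// in h.
  have -> : lam ^+ 2 * lam ^+ k = lam ^+ k / lam + (lam ^+ 3 - 1) * (lam^-1 * lam ^+ k).
    by field; rewrite gt_eqF.
  by rewrite lerD2l.
have mhalf : 0 < mass (radius_below k) <= 1 / 2 by rewrite m0 (le_trans mle).
apply: (le_trans (none_isolated_le r0 fm mhalf)); rewrite lee_fin.
apply: second_moment_estimate => //.
have h : mass (radius_below k) <= 1 - lam^-1 by exact: le_trans small3.
rewrite -[leRHS]invrK lef_pV2 ?posrE ?invr_gt0//; lra.
Qed.

Let dn n w : \bar R :=
  no_isolated_radius g (N n w) (fun i => X i w) (fun i j => U i j w).
Let ratio n w : \bar R := ((alpha * n%:R / ln n%:R)%:E * dn n w ^+ d)%E.

Let dn_le k n w : 0 < radius_above k -> (few k <= N n w <= many k)%N ->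
  ~ (exists2 i, (i < many k)%N & isolated (radius_above k) i (few k) w) ->
  (dn n w <= (radius_above k)%:E)%E.
Proof.
move=> r0 /andP[fN Nm] none; apply: no_isolated_radius_le => // i iN iso.
apply: none; exists i; first exact: leq_trans Nm.
by move=> j jf ji; apply: iso => //; exact: leq_trans fN.
Qed.

Let dn_ge k n w : (few k <= N n w <= many k)%N ->
  ~ (forall i, (i < few k)%N -> ~ isolated (radius_below k) i (many k) w) ->
  ((radius_below k)%:E <= dn n w)%E.
Proof.
move=> /andP[fN Nm] /existsNP[i /not_implyP[ifew /contrapT iso]].
apply: (no_isolated_radius_ge g_noninc (i := i)); first exact: leq_trans fN.
by move=> j jN ji; apply: iso => //; exact: leq_trans Nm.
Qed.

Let block (n : nat) : (0 < n)%N -> exists k : nat,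
  [/\ lam ^+ k <= n%:R, n%:R < lam ^+ k.+1, k%:R * l <= ln n%:R & ln n%:R < k.+1%:R * l].
Proof.
move=> n0; have n0' : 0 < n%:R :> R by rewrite ltr0n.
have ln0 : 0 <= ln n%:R / l.
  by rewrite divr_ge0 ?(ltW l0)// ln_ge0// ler1n.
have /andP[k1 k2] := truncn_itv ln0; exists (Num.truncn (ln n%:R / l)).
rewrite ler_pdivlMr// in k1; rewrite ltr_pdivrMr// in k2.
have lamE k : lam ^+ k = expR (k%:R * l) by rewrite expRM_natl lnK.
split => //; rewrite lamE -[n%:R]lnK ?posrE//.
  by rewrite ler_expR lnK.
by rewrite ltr_expR lnK.
Qed.

Let in_range k n m : lam ^+ k <= n%:R -> n%:R < lam ^+ k.+1 ->
  n%:R / lam < m%:R < lam * n%:R -> (few k <= m <= many k)%N.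
Proof.
move=> kn nk /andP[m1 m2]; apply/andP; split.
  rewrite /few truncn_lt_nat; last by rewrite divr_ge0 ?ltW.
  by apply: le_lt_trans m1; rewrite ler_pM2r ?invr_gt0.
rewrite /many truncn_ge_nat; last by rewrite mulr_ge0 ?exprn_ge0 ?ltW.
rewrite (le_trans (ltW m2))// expr2 -mulrA ler_pM2l//.
by rewrite -exprS ltW.
Qed.

Lemma ae_ratio_near_1 : {ae P, forall w, \forall n \near \oo,
  ((1 - eps)%:E <= ratio n w <= (1 + eps)%:E)%E}.
Proof.
have := poisson_concentration N_poisson lam1.
apply: filterS3 ae_none_isolated_above ae_some_isolated_below.
move=> w [k1 _ above] [k2 _ below] [n1 _ conc].
pose k0 := maxn 1 (maxn k1 k2).
exists (maxn n1 (Num.truncn (lam ^+ k0)).+1) => // n /=.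
rewrite geq_max => /andP[n1n k0n].
have nk0 : lam ^+ k0 < n%:R by rewrite -truncn_lt_nat ?exprn_ge0 ?ltW.
have n0 : (0 < n)%N by rewrite (leq_trans _ k0n).
have n0' : 0 < n%:R :> R by rewrite ltr0n.
have [k [kn nk kl lk]] := block n0.
have k0k : (k0 <= k)%N.
  rewrite leqNgt; apply/negP => kk0.
  have : lam ^+ k.+1 <= lam ^+ k0 by rewrite ler_weXn2l// ltW.
  by move=> h; have := lt_trans nk (le_lt_trans h nk0); rewrite ltxx.
move: k0k; rewrite /k0 !geq_max => /and3P[kpos k1k k2k].
have range := in_range kn nk (conc n n1n).
have kl0 : 0 < k%:R * l by rewrite mulr_gt0// ltr0n.
have lnn0 : 0 < ln n%:R :> R by exact: lt_le_trans kl.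
have c0 : 0 < alpha * n%:R / ln n%:R by rewrite divr_gt0// mulr_gt0.
have ra0 : 0 < radius_above k.
  apply: dth_root_gt0; rewrite divr_gt0// /volume_above divr_gt0 ?mulr_gt0 ?addr_gt0//.
  by rewrite ltr0n.
have cE r : alpha * n%:R / ln n%:R * r ^+ d = n%:R / ln n%:R * (alpha * r ^+ d).
  by ring.
apply/andP; split.
  have h := gee_pow_radius c0 d0 (dth_root_ge0 _ _) (dn_ge range (below k k2k)).
  apply: le_trans h; rewrite lee_fin cE radius_belowE /volume_below.
  rewrite mulrAC ler_pdivlMr//.
  have -> : n%:R * ((1 - eps) * k.+1%:R * l / lam ^+ k) =
      (1 - eps) * (n%:R / lam ^+ k * (k.+1%:R * l)) by ring.
  rewrite ler_wpM2l ?subr_ge0 ?(ltW e1)// -[leLHS]mul1r.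
  by rewrite ler_pM ?(ltW lnn0)// ?(ltW lk)// ler_pdivlMr ?mul1r.
have h := lee_pow_radius d (ltW c0) (no_isolated_radius_ge0 _ _ _ _)
  (dn_le ra0 range (above k k1k)).
apply: le_trans h _; rewrite lee_fin cE radius_aboveE /volume_above.
rewrite mulrAC ler_pdivrMr//.
have -> : n%:R * ((1 + eps) * k%:R * l / (lam ^+ k * lam)) =
    (1 + eps) * (n%:R / (lam ^+ k * lam) * (k%:R * l)) by ring.
rewrite ler_wpM2l ?addr_ge0 ?(ltW e0)// -[leRHS]mul1r.
rewrite ler_pM ?(ltW kl0)//; first by rewrite divr_ge0 ?mulr_ge0 ?ltW.
by rewrite ler_pdivrMr ?mulr_gt0// mul1r -exprSr ltW.
Qed.

End fixed_precision.

Let ratio (w : Omega) (n : nat) : \bar R := ((alpha * n%:R / ln n%:R)%:E *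
  no_isolated_radius g (N n w) (fun i => X i w) (fun i j => U i j w) ^+ d)%E.

(** The second inequality is an equality for [lam ^+ 3 = c], and then the third one
    reads [1 - eps ^+ 2 <= 1 - eps ^+ 2 / 4]. *)
Let precision_lam (eps : R) : 0 < eps < 1 -> exists lam : R,
  [/\ 1 < lam, (1 + eps / 2) * lam ^+ 3 <= 1 + eps & (1 - eps) * lam ^+ 3 <= 1 - eps / 2].
Proof.
move=> /andP[e0 e1]; pose c := (1 + eps) / (1 + eps / 2).
have c1 : 1 < c by rewrite /c ltr_pdivlMr; lra.
have c0 : 0 < c by exact: lt_trans c1.
have r3 : dth_root 3 c ^+ 3 = c by rewrite dth_rootK// ltW.
exists (dth_root 3 c); rewrite r3; split.
- rewrite ltNge; apply/negP => r1; move: c1; apply/negP.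
  by rewrite -leNgt -r3 exprn_ile1// dth_root_ge0.
- by rewrite /c mulrC divfK//; lra.
- by rewrite /c mulrA ler_pdivrMr; [have := sqr_ge0 eps; rewrite expr2; lra|lra].
Qed.

Lemma ae_ratio_cvg : {ae P, forall w, ratio w n @[n --> \oo] --> 1%E}.
Proof.
pose e (q : nat) : R := q.+2%:R^-1.
have e01 q : 0 < e q < 1.
  by rewrite /e invr_gt0 ltr0n/= invf_lt1 ?ltr0n// ltr1n.
have : {ae P, forall w, forall q : nat, \forall n \near \oo,
    ((1 - e q)%:E <= ratio w n <= (1 + e q)%:E)%E}.
  apply: ae_foralln => q; have [lam [l1 l2 l3]] := precision_lam (e01 q).
  exact: (ae_ratio_near_1 l1 (e01 q) l2 l3).
apply: filterS => w H; apply: cvg_to_1e => eps /andP[e0 _].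
pose q := Num.truncn eps^-1.
have qe : e q <= eps.
  rewrite -[leRHS]invrK lef_pV2 ?posrE ?invr_gt0 ?ltr0n//.
  by rewrite (le_trans (ltW (truncnS_gt _)))// ler_nat.
apply: filterS (H q) => n /andP[h1 h2]; apply/andP; split.
  by apply: le_trans h1; rewrite lee_fin lerB.
by apply: (le_trans h2); rewrite lee_fin lerD.
Qed.

End strong_law.

Theorem theorem1p2
  (R : realType) (d : nat) (hd : (2 <= d)%N)
  (g : R -> R)
  (g01 : forall t : R, 0 <= t -> 0 <= g t <= 1)
  (g_noninc : forall s t : R, 0 <= s -> s <= t -> g t <= g s)
  (alpha : R) (alpha_gt0 : 0 < alpha)
  (alphaE : (\int[leb R d]_x (g (enorm x))%:E = alpha%:E)%E)
  (disp : measure_display) (Omega : measurableType disp)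
  (P : probability Omega R)
  (X : nat -> {RV P >-> Rn R d})
  (N : nat -> {RV P >-> nat})
  (U : nat -> nat -> {RV P >-> R})
  (X_unif : forall (i : nat) (A : set (Rn R d)), measurable A ->
     distribution P (X i) A = leb R d (A `&` torus R d))
  (X_indep : independent_family P setT (fun (i : nat) (w : Omega) => X i w))
  (N_poisson : forall n k : nat, (0 < n)%N ->
     distribution P (N n) [set k] = (poisson_pmf (n%:R : R) k)%:E)
  (N_nondec : forall (m n : nat) (w : Omega), (0 < m)%N -> (m <= n)%N ->
     (N m w <= N n w)%N)
  (U_unif : forall (i j : nat) (A : set R), (i < j)%N -> measurable A ->
     distribution P (U i j) A = uniform_prob (@ltr01 R) A)
  (U_indep : independent_family P [set p : nat * nat | (p.1 < p.2)%N]
     (fun p w => U p.1 p.2 w))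
  (XNU_indep : independent_sigma3 P
     (sigma_family setT (fun (i : nat) (w : Omega) => X i w))
     (sigma_family [set n : nat | (0 < n)%N] (fun n w => N n w))
     (sigma_family [set p : nat * nat | (p.1 < p.2)%N]
        (fun p w => U p.1 p.2 w))) :
  let dn (n : nat) (w : Omega) : \bar R :=
    no_isolated_radius g (N n w) (fun i => X i w) (fun i j => U i j w) in
  let ratio (w : Omega) (n : nat) : \bar R :=
    ((alpha * n%:R / ln n%:R)%:E * dn n w ^+ d)%E in
  [/\ (exists2 c : R, d%:R < c & (g : R -> R^o) =o_ +oo (fun r : R => r `^ (- c) : R^o)) ->
        {ae P, forall w, (limn_esup (ratio w) <= 1)%E},
      (exists2 c : R, 0 < c & (g : R -> R^o) =o_ +oo (fun r : R => expR (- c * r) : R^o)) ->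
        {ae P, forall w, ratio w n @[n --> \oo] --> 1%E}
    & forall c : R, 3 * d%:R < c -> (g : R -> R^o) =o_ +oo (fun r : R => r `^ (- c) : R^o) ->
        {ae P, forall w,
          (((c - 3 * d%:R) / (c - d%:R))%:E <= limn_einf (ratio w))%E}].
Proof.
move=> dn ratio.
have U_tail i j (a : R) : (i < j)%N -> 0 <= a <= 1 ->
    P (U i j @^-1` `]a, +oo[%classic) = (1 - a)%:E.
  move=> ij a01; rewrite -(uniform_prob_tail a01) -(U_unif i j _ ij)//.
have XU_indep A B : sigma_family setT (fun (i : nat) (w : Omega) => X i w) A ->
    sigma_family [set p : nat * nat | (p.1 < p.2)%N] (fun p w => U p.1 p.2 w) B ->
    (P (A `&` B) = P A * P B)%E.
  move=> sA sB.
  have sT : sigma_family [set n : nat | (0 < n)%N] (fun n w => N n w) setT.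
    exact: (@measurableT _ (g_sigma_algebraType _)).
  by have := XNU_indep _ _ _ sA sT sB; rewrite setIT probability_setT mule1.
have lim : {ae P, forall w, ratio w n @[n --> \oo] --> 1%E}.
  exact: (ae_ratio_cvg (ltnW hd) g01 g_noninc alpha_gt0 alphaE X_unif X_indep
    N_poisson U_tail U_indep XU_indep).
split => [_|_|c c3 _].
- by apply: filterS lim => w /cvg_limn_einf_sup[_ ->].
- exact: lim.
- apply: filterS lim => w /cvg_limn_einf_sup[-> _].
  have dR : 2 <= d%:R :> R by rewrite ler_nat.
  by rewrite lee_fin ler_pdivrMr; lra.
Qed.
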